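(* If $u,\varphi\in AC_g([a,b])$, then $u\varphi\in AC_g([a,b])$ and, $\mu_g$-almost everywhere, $$D_g(u\varphi)=u\,D_g\varphi+(D_gu)\,S_g\varphi=(S_gu)\,D_g\varphi+(D_gu)\,\varphi .$$
   Context: Let $\mathbb F$ be $\mathbb R$ or $\mathbb C$, let $a<b$ be real, and let $g:[a,b]\to\mathbb R$ be nondecreasing and left-continuous. $\mu_g$ is the finite Lebesgue--Stieltjes measure on $[a,b)$ with $\mu_g([s,t))=g(t)-g(s)$ for $a\le s\le t\le b$. Standing assumption: $M_g:=\mu_g([a,b))=g(b)-g(a)>0$. For $1\le p\le\infty$, $L_g^p([a,b))$ is the $L^p$ space of $\mathbb F$-valued functions for the completion of $\mu_g$ (modulo $\mu_g$-a.e. equality). $J_g:=\{t\in[a,b):\Delta g(t):=g(t^+)-g(t)>0\}$ is the set of jump points, so $\mu_g(\{t\})=\Delta g(t)$ for $t\in J_g$. $AC_g([a,b])$ is the set of $u:[a,b]\to\mathbb F$ such that for every $\varepsilon>0$ there is $\delta>0$ such that, for every finite family of pairwise disjoint intervals $[a_j,b_j)\subset[a,b)$, $\sum_j(g(b_j)-g(a_j))<\delta$ implies $\sum_j|u(b_j)-u(a_j)|<\varepsilon$. It is known that $u\in AC_g([a,b])$ if and only if there is $v\in L_g^1([a,b))$ with $u(t)=u(a)+\int_{[a,t)}v\,d\mu_g$ for all $t\in[a,b]$; $v$ is unique $\mu_g$-a.e. and the Stieltjes derivative is $D_gu:=v$. Posterior trace: for $u\in AC_g([a,b])$, $S_gu(t):=u(t^+)$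 if $t\in J_g$ and $S_gu(t):=u(t)$ if $t\notin J_g$. *)

(* Defs.v *)
From HB Require Import structures.
From mathcomp Require Import all_boot all_order all_algebra.
From mathcomp Require Import complex.
From mathcomp Require Import all_classical all_reals all_analysis measurable_realfun.

Set Implicit Arguments.
Unset Strict Implicit.
Unset Printing Implicit Defensive.
Import Order.TTheory GRing.Theory Num.Theory.
Import numFieldNormedType.Exports.

Local Open Scope classical_set_scope.
Local Open Scope ring_scope.

Inductive scalar_kind := RealScalar | ComplexScalar.

Definition scalar_field (R : realType) (k : scalar_kind) : numFieldType :=
  match k with
  | RealScalar => (R : numFieldType)
  | ComplexScalar => (R[i] : numFieldType)
  end.

Section scalar_integration.
Context d (T : measurableType d) (R : realType).
Variable mu : {measure set T -> \bar R}.

Definition scalar_integrable (k : scalar_kind) (D : set T) :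
    (T -> scalar_field R k) -> Prop :=
  match k with
  | RealScalar => fun f : T -> R => mu.-integrable D (EFin \o f)
  | ComplexScalar => fun f : T -> R[i] =>
      mu.-integrable D (fun t => (complex.Re (f t))%:E) /\
      mu.-integrable D (fun t => (complex.Im (f t))%:E)
  end.

Definition scalar_integral (k : scalar_kind) (D : set T) :
    (T -> scalar_field R k) -> scalar_field R k :=
  match k with
  | RealScalar => fun f : T -> R => \int[mu]_(t in D) f t
  | ComplexScalar => fun f : T -> R[i] =>
      complex.Complex (\int[mu]_(t in D) complex.Re (f t))
                      (\int[mu]_(t in D) complex.Im (f t))
  end.

End scalar_integration.

(* Only the values of g on [a, b] are constrained; the other ones are never
   used. *)
Record integrator (R : realType) (a b : R) := Integrator {
  integrator_fun :> R -> R;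
  integrator_lt : a < b;
  integrator_nd : forall s t, a <= s -> s <= t -> t <= b ->
    integrator_fun s <= integrator_fun t;
  integrator_lc : forall t, a < t -> t <= b ->
    integrator_fun x @[x --> t^'-] --> integrator_fun t
}.

Section stieltjes_measure.
Context (R : realType) (a b : R).
Variable g : integrator a b.

Let ab : a <= b. Proof. exact/ltW/(integrator_lt g). Qed.

Definition clip (x : R) : R := Num.max a (Num.min x b).

Lemma clip_ge x : a <= clip x.
Proof. by rewrite /clip le_max lexx. Qed.

Lemma clip_le x : clip x <= b.
Proof. by rewrite /clip ge_max ab ge_min lexx orbT. Qed.

Lemma clip_id x : a <= x -> x <= b -> clip x = x.
Proof. by move=> ax xb; rewrite /clip min_l// max_r. Qed.

Lemma clip_nd x y : x <= y -> clip x <= clip y.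
Proof.
move=> xy.
by rewrite /clip ge_max le_max lexx /= le_max le_min !ge_min lexx xy !orbT.
Qed.

(* The library builds Lebesgue-Stieltjes measures from right-continuous
   functions, with mass f t - f s on ]s, t]. The left-continuous g is therefore
   extended by constants outside [a, b] and reflected into the right-continuous
   x |-> - g (- x), whose measure is pushed forward along x |-> - x; the
   result is null outside [a, b[ (see stieltjes_measure_itv for its values
   inside). *)
Definition reflected (x : R) : R := - g (clip (- x)).

Let reflected_nd : nondecreasing reflected.
Proof.
move=> x y xy; rewrite /reflected lerN2.
apply: integrator_nd; [exact: clip_ge| |exact: clip_le].
by apply: clip_nd; rewrite lerN2.
Qed.

Let clip_lc (t : R) : g (clip x) @[x --> t^'-] --> g (clip t).
Proof.
have [ta|at_] := leP t a.
  apply: cvg_near_cst; near=> x.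
  have xt : x < t by near: x; exact: nbhs_left_lt.
  by rewrite /clip !max_l// ge_min ?ta ?(le_trans (ltW xt)).
have [tb|bt] := leP t b.
  rewrite clip_id ?(ltW at_)//.
  apply: (cvg_trans _ (integrator_lc at_ tb)); apply: near_eq_cvg; near=> x.
  have xt : x < t by near: x; exact: nbhs_left_lt.
  have ax : a < x by near: x; exact: nbhs_left_gt.
  by rewrite clip_id ?(ltW ax)// (le_trans (ltW xt)).
apply: cvg_near_cst; near=> x.
have bx : b < x by near: x; exact: nbhs_left_gt.
by rewrite /clip !min_r// ltW.
Unshelve. all: by end_near. Qed.

Let reflected_rc : right_continuous reflected.
Proof.
move=> x; apply/cvg_at_rightNP; rewrite /reflected.
apply: (cvg_trans _ (cvgN (@clip_lc (- x)))); apply: near_eq_cvg; near=> y.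
by rewrite /= opprK.
Unshelve. all: by end_near. Qed.

HB.instance Definition _ :=
  isCumulative.Build R _ R reflected reflected_nd reflected_rc.

Definition opp_fun : measurableTypeR R -> measurableTypeR R := fun x : R => - x.

Let measurable_opp_fun : measurable_fun setT opp_fun.
Proof. exact: oppr_measurable. Qed.

Definition borel_stieltjes_measure : set (measurableTypeR R) -> \bar R :=
  pushforward (lebesgue_stieltjes_measure reflected) opp_fun.

Let borel_stieltjes_measure0 : borel_stieltjes_measure set0 = 0%E.
Proof. by rewrite /borel_stieltjes_measure /pushforward preimage_set0 measure0. Qed.

Let borel_stieltjes_measure_ge0 A : (0 <= borel_stieltjes_measure A)%E.
Proof. exact: measure_ge0. Qed.

Let borel_stieltjes_measure_sigma_additive :
  semi_sigma_additive borel_stieltjes_measure.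
Proof.
move=> F mF tF mUF; rewrite /borel_stieltjes_measure /pushforward.
rewrite preimage_bigcup; apply: measure_semi_sigma_additive.
- by move=> n; rewrite -[X in measurable X]setTI; exact: measurable_opp_fun.
- apply/trivIsetP => /= i j _ _ ij; rewrite -preimage_setI.
  by move/trivIsetP : tF => /(_ _ _ _ _ ij) ->//; rewrite preimage_set0.
- rewrite -preimage_bigcup -[X in measurable X]setTI.
  exact: measurable_opp_fun.
Qed.

HB.instance Definition _ := isMeasure.Build _ _ _ borel_stieltjes_measure
  borel_stieltjes_measure0 borel_stieltjes_measure_ge0
  borel_stieltjes_measure_sigma_additive.

Lemma borel_stieltjes_measure_itv s t : a <= s -> s <= t -> t <= b ->
  borel_stieltjes_measure `[s, t[%classic = (g t - g s)%:E.
Proof.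
move=> as_ st tb; rewrite /borel_stieltjes_measure/= /pushforward.
rewrite (_ : opp_fun @^-1` `[s, t[%classic = `](- t), (- s)]%classic); last first.
  apply/seteqP; split => x /=; rewrite !in_itv/= /opp_fun.
    by move=> /andP[? ?]; rewrite ltrNl lerNr; apply/andP.
  by rewrite ltrNl lerNr => /andP[? ?]; apply/andP.
rewrite /lebesgue_stieltjes_measure /measure_extension/= measurable_mu_extE/=; last first.
  exact: is_ocitv.
rewrite wlength_itv_bnd ?lerN2// /reflected !opprK !clip_id//.
- by rewrite addrC.
- exact: le_trans as_ st.
- exact: le_trans st tb.
Qed.

(* The Caratheodory extension of the finite Borel measure, that is, its
   completion. *)
Definition stieltjes_measure :=
  @completed_measure_extension _ _ _ borel_stieltjes_measure.

HB.instance Definition _ := Measure.on stieltjes_measure.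

Lemma stieltjes_measure_itv s t : a <= s -> s <= t -> t <= b ->
  stieltjes_measure `[s, t[%classic = (g t - g s)%:E.
Proof.
move=> as_ st tb; rewrite -borel_stieltjes_measure_itv//.
by rewrite /stieltjes_measure /completed_measure_extension measurable_mu_extE.
Qed.

End stieltjes_measure.
Arguments stieltjes_measure {R a b} g _.
Arguments borel_stieltjes_measure {R a b} g _.

Section stieltjes_calculus.
Context (R : realType) (a b : R) (g : integrator a b) (k : scalar_kind).
Local Notation F := (scalar_field R k).
Local Notation mu := (stieltjes_measure g).
Implicit Types u v : R -> F.

(* The order of R[i] only compares numbers with the same imaginary part, so
   that 0 < eps forces eps to be a positive real, for both scalar fields. *)
Definition stieltjes_AC u := forall eps : F, 0 < eps ->
  exists2 delta : R, 0 < delta &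
    forall (n : nat) (s t : 'I_n -> R),
      (forall j, s j < t j) ->
      (forall j, `[s j, t j[ `<=` `[a, b[) ->
      trivIset setT (fun j => `[s j, t j[%classic) ->
      \sum_j (g (t j) - g (s j)) < delta ->
      \sum_j `|u (t j) - u (s j)| < eps.

Definition is_stieltjes_derivative u v :=
  scalar_integrable mu `[a, b[ v /\
  forall t, a <= t <= b -> u t = u a + scalar_integral mu `[a, t[ v.

(* A representative of the mu-a.e. class; the junk value is 0. *)
Definition stieltjes_derivative u : R -> F :=
  xget (fun=> 0) [set v | is_stieltjes_derivative u v].

Definition jump_points : set R :=
  [set t | a <= t < b /\ 0 < lim (g x @[x --> t^'+]) - g t].

Definition posterior_trace u (t : R) : F :=
  if t \in jump_points then lim (u x @[x --> t^'+]) else u t.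

End stieltjes_calculus.

(* Main.v *)
From HB Require Import structures.
Require Import Defs.
From mathcomp Require Import all_boot all_order all_algebra.
From mathcomp Require Import complex ring lra.
From mathcomp Require Import all_classical all_reals all_analysis measurable_realfun.
Import Order.TTheory GRing.Theory Num.Theory.
Import numFieldNormedType.Exports.

(** A real AC_g function u has finite total variation V, and V inherits the AC_g
property, so u = V - (V - u) is a difference of nondecreasing left-continuous
AC_g functions. The Stieltjes measure of such a function is absolutely
continuous with respect to mu_g, and Radon-Nikodym yields a Borel density of u.
For densities v of u and w of phi, split the square [a, t[ x [a, t[ along its
diagonal, the diagonal going to one side only: Fubini gives
  (int v) (int w) = int w(y) (u(y) - u(a)) dy + int v(x) (int_[a, x] w) dx,
and phi(a) + int_[a, x] w is the right limit of phi at x, that is, the posterior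
trace (when x is not a jump point, {x} is null). Finally an integrable function
whose integrals over all [a, t[ vanish is null almost everywhere, so that this
density is the Stieltjes derivative. Complex functions are treated by
components. *)

Set Implicit Arguments.
Unset Strict Implicit.
Unset Printing Implicit Defensive.

Local Open Scope classical_set_scope.
Local Open Scope ring_scope.

(** * Finite families of intervals [[s, t[] and the pieces of a partition *)

Section interval_families.
Context {R : realType}.
Implicit Types (a b : R) (p q : R * R) (L : seq (R * R)).

(** A boolean condition on endpoints in place of disjointness. The two agree for nonempty intervals,
    but an empty interval strictly inside another one is not apart from it. *)
Definition itv_apart p q := (p.2 <= q.1) || (q.2 <= p.1).

Definition itv_family a b L :=
  all (fun p => [&& a <= p.1, p.1 <= p.2 & p.2 <= b]) L && pairwise itv_apart L.

Lemma itv_apartC p q : itv_apart p q = itv_apart q p.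
Proof. by rewrite /itv_apart orbC. Qed.

Lemma itv_apart_disjoint p q x : itv_apart p q ->
  x \in `[p.1, p.2[ -> x \in `[q.1, q.2[ -> False.
Proof.
rewrite !in_itv/= => /orP[pq|qp] /andP[px xp] /andP[qx xq].
  by have := lt_le_trans xp (le_trans pq qx); rewrite ltxx.
by have := lt_le_trans xq (le_trans qp px); rewrite ltxx.
Qed.

Definition seq_AC a b (g u : R -> R) := forall e : R, 0 < e ->
  exists2 d : R, 0 < d & forall L, itv_family a b L ->
    \sum_(p <- L) (g p.2 - g p.1) < d ->
    \sum_(p <- L) `|u p.2 - u p.1| < e.

Lemma itv_family_bounds a b L : itv_family a b L ->
  forall p, p \in L -> [/\ a <= p.1, p.1 <= p.2 & p.2 <= b].
Proof. by move=> /andP[/allP aL _] p /aL /and3P. Qed.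

Definition pieces a (s : seq R) := zip (a :: s) s.

Lemma pieces_itv_family a b s : itv_partition a b s -> itv_family a b (pieces a s).
Proof.
elim: s a => [//|x s ih] a abs; have [ax] : a < x /\ itv_partition x b s.
  by split; [case: abs => /= /andP[]|exact: itv_partition_cons abs].
move=> xbs; have /andP[/allP fa fp] := ih _ xbs.
have xb := itv_partition_le xbs.
apply/andP; split => /=; rewrite -/(pieces x s).
  rewrite lexx (ltW ax) xb /=; apply/allP => p /fa /and3P[xp -> ->].
  by rewrite (le_trans (ltW ax) xp).
rewrite fp andbT; apply/allP => p /fa /and3P[xp _ _].
by rewrite /itv_apart/= xp.
Qed.

Lemma pieces_sum (f : R -> R) a b s : itv_partition a b s ->
  \sum_(p <- pieces a s) (f p.2 - f p.1) = f b - f a.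
Proof.
elim: s a => [|x s ih] a abs.
  by rewrite big_nil (itv_partition_nil abs) subrr.
rewrite big_cons/= -/(pieces x s) (ih _ (itv_partition_cons abs)).
by rewrite addrC subrKA.
Qed.

Lemma pieces_variation (f : R -> R) a b s : itv_partition a b s ->
  \sum_(p <- pieces a s) `|f p.2 - f p.1| = variation a b f s.
Proof.
move=> abs; rewrite variation_zip//.
elim: s a {abs} => [|x s ih] a; first by rewrite !big_nil.
by rewrite !big_cons/= -ih.
Qed.

End interval_families.

(** * Absolute continuity passes to the total variation *)

Section absolutely_continuous_variation.
Context {R : realType} (a b : R).
Implicit Types (p q : R * R) (L : seq (R * R)).
Local Notation TV := total_variation.

Lemma itv_apart_sub p q x : p.1 <= q.1 -> q.2 <= p.2 ->
  itv_apart x p -> itv_apart x q.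
Proof.
move=> pq qp /orP[xp|px]; rewrite /itv_apart.
  by rewrite (le_trans xp pq).
by rewrite (le_trans qp px) orbT.
Qed.

(** The pieces lie inside [p], so they are apart from whatever [p] was apart from, and consecutive
    pieces are apart from one another. *)
Lemma itv_family_refine L L' p s : itv_family a b (L ++ p :: L') ->
  itv_partition p.1 p.2 s -> itv_family a b ((L ++ pieces p.1 s) ++ L').
Proof.
move=> /andP[]; rewrite all_cat/= => /and3P[aL /and3P[ap pp pb] aL'].
rewrite pairwise_cat/= allrel_consr => /and4P[/andP[Lp LL'] pL pL' pwL'].
move=> ps; have fs := pieces_itv_family ps.
have sub x : itv_apart x p -> all (itv_apart x) (pieces p.1 s).
  move=> xp; apply/allP => q /(itv_family_bounds fs)[pq _ qp].
  exact: itv_apart_sub xp.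
apply/andP; split.
  rewrite !all_cat aL aL' andbT/=; apply/allP => q.
  move=> /(itv_family_bounds fs)[pq -> qp].
  by rewrite (le_trans ap pq) (le_trans qp pb).
rewrite !pairwise_cat allrel_catl LL' pL pwL' andbT/=.
case/andP : fs => _ ->; rewrite andbT; apply/andP; split.
  apply/allrelP => q x qs xL'.
  rewrite itv_apartC; move: qs; apply/allP/sub.
  by rewrite itv_apartC; apply: (allP pL').
by apply/allrelP => x q xL; apply/allP/sub; exact: (allP Lp).
Qed.

Variables (g u : R -> R).
Hypothesis acu : seq_AC a b g u.

Lemma seq_AC_total_variation (e : R) : 0 < e ->
  exists2 d : R, 0 < d & forall L, itv_family a b L ->
    \sum_(p <- L) (g p.2 - g p.1) < d ->
    (\sum_(p <- L) TV p.1 p.2 u <= e%:E)%E.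
Proof.
move=> /acu[d d0 acd]; exists d => // L.
(* The total variations are replaced one at a time by variations along
   partitions, whose pieces join the family L1. *)
suff H : forall L1 L2, itv_family a b (L1 ++ L2) ->
    \sum_(p <- L1 ++ L2) (g p.2 - g p.1) < d ->
    ((\sum_(p <- L1) `|u p.2 - u p.1|)%:E + \sum_(p <- L2) TV p.1 p.2 u <= e%:E)%E.
  by move=> fL gL; have := H [::] L fL gL; rewrite big_nil add0e.
move=> L1 L2; elim: L2 L1 => [|p L2 ih] L1 fL gL.
  by rewrite big_nil adde0 lee_fin ltW//; apply: acd; rewrite -[L1]cats0.
have [_ pp _] : [/\ a <= p.1, p.1 <= p.2 & p.2 <= b].
  by apply: (itv_family_bounds fL); rewrite mem_cat mem_head orbT.
have key s : itv_partition p.1 p.2 s ->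
    ((variation p.1 p.2 u s)%:E + ((\sum_(p <- L1) `|u p.2 - u p.1|)%:E +
       \sum_(p <- L2) TV p.1 p.2 u) <= e%:E)%E.
  move=> ps; have := ih _ (itv_family_refine fL ps).
  rewrite [X in (X%:E + _ <= _)%E]big_cat/= (pieces_variation _ ps) EFinD => H.
  rewrite addeA [X in (X + _)%E]addeC; apply: H.
  (* Increments of [g] over the pieces telescope, so refining leaves the sum that is compared with
     [d] unchanged. *)
  move: gL; rewrite !big_cat/= big_cons (pieces_sum _ ps).
  by rewrite addrA.
have L20 : (0 <= \sum_(p <- L2) TV p.1 p.2 u)%E.
  rewrite big_seq; apply: sume_ge0 => q qL; apply: total_variation_ge0.
  have [//] : [/\ a <= q.1, q.1 <= q.2 & q.2 <= b].
  by apply: (itv_family_bounds fL); rewrite mem_cat inE qL !orbT.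
rewrite big_cons addeCA.
set X := (X in (_ + X <= _)%E); rewrite -/X in key.
have [s0 ps0] : exists s, itv_partition p.1 p.2 s.
  move: pp; rewrite le_eqVlt => /predU1P[->|/itv_partition1]; last by exists [:: p.2].
  by exists [::].
have X0 : (0 <= X)%E by rewrite adde_ge0// lee_fin sumr_ge0.
(* Finiteness of [X] allows it to be moved across the inequality in the extended reals, which leaves
   a supremum over partitions to bound; [key] for a single partition gives it. *)
have Xfin : X \is a fin_num.
  rewrite ge0_fin_numE//; apply: le_lt_trans (ltry e); apply: le_trans (key _ ps0).
  by rewrite leeDr// lee_fin variation_ge0.
rewrite -leeBrDr//; apply: ge_ereal_sup => _ [_ [s ps <-] <-].
by rewrite leeBrDr// key.
Qed.

End absolutely_continuous_variation.

(** * Absolutely continuous functions have bounded variation *)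

Section bounded_variation.
Context {R : realType} (a b : R) (g : integrator a b) (u : R -> R).
Hypothesis acu : seq_AC a b g u.
Local Notation TV := total_variation.

Lemma seq_AC_itv (e : R) : 0 < e -> exists2 d : R, 0 < d & forall s t,
  a <= s -> s <= t -> t <= b -> g t - g s < d -> (TV s t u <= e%:E)%E.
Proof.
move=> /(seq_AC_total_variation acu)[d d0 H]; exists d => // s t as_ st tb gst.
have := H [:: (s, t)]; rewrite !big_seq1/=; apply => //.
by rewrite /itv_family/= as_ st tb.
Qed.

Lemma integrator_left_near (t d : R) : a < t -> t <= b -> 0 < d ->
  exists s, [/\ a <= s, s < t & forall x, s <= x -> x <= t -> g t - g x < d].
Proof.
move=> at_ tb d0; have /cvgrPdist_lt/(_ _ d0) := @integrator_lc _ _ _ g t at_ tb.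
move=> near_t; near t^'- => s.
have as_ : a < s by near: s; exact: nbhs_left_gt.
have st : s < t by near: s; exact: nbhs_left_lt.
have gs : `|g t - g s| < d by near: s.
exists s; split => //; first exact: ltW.
move=> x sx xt; apply: le_lt_trans gs.
rewrite (le_trans _ (ler_norm _))// lerD2l lerN2.
apply: integrator_nd => //; last exact: le_trans xt tb.
exact: ltW.
Unshelve. all: by end_near. Qed.

(** By monotonicity the right limit of [g] at [t] is the infimum of its values on []t, b]], and [y]
    nearly attains it. The point [t] itself is excluded, since [g] may jump there. *)
Lemma integrator_right_near (t d : R) : a <= t -> t < b -> 0 < d ->
  exists y, [/\ t < y, y <= b &
    forall x x', t < x -> x <= x' -> x' <= y -> g x' - g x < d].
Proof.
move=> at_ tb d0; pose A := [set g x | x in `]t, b]%classic].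
have A0 : has_inf A.
  split; first by exists (g b); exists b => //=; rewrite in_itv/= tb lexx.
  exists (g t) => _ [x /= + <-]; rewrite in_itv/= => /andP[tx xb].
  by apply: integrator_nd => //; exact: ltW.
have [_ [y /= + <-] gy] := inf_adherent d0 A0.
rewrite in_itv/= => /andP[ty yb]; exists y; split => // x x' tx xx' x'y.
rewrite ltrBlDr (le_lt_trans (y := g y))//.
  apply: integrator_nd => //.
  exact: le_trans (le_trans at_ (ltW tx)) xx'.
apply: (lt_le_trans gy); rewrite addrC lerD2l.
apply: ge_inf; first by case: A0.
by exists x => //=; rewrite in_itv/= tx (le_trans xx')// (le_trans x'y).
Qed.

Lemma seq_AC_bounded_variation : (TV a b u < +oo)%E.
Proof.
have ab : a < b := integrator_lt g.
have [d d0 H] := seq_AC_itv ltr01.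
(* The supremum of the t such that TV a t is finite is attained because g is
   left-continuous, and is b because g has right limits. *)
pose S := [set t | [/\ a <= t, t <= b & (TV a t u < +oo)%E]].
have Sa : S a by rewrite /S/= lexx (ltW ab) total_variationxx ltry.
have hS : has_sup S by split; [exists a|exists b => x []].
pose c := sup S.
have ac : a <= c by apply: ub_le_sup => //; case: hS.
have cb : c <= b by apply: ge_sup => [|x []//]; exists a.
have Sc : S c.
  split => //; have [->|] := eqVneq c a; first by rewrite total_variationxx ltry.
  rewrite neq_lt ltNge ac/= => {}ac.
  have [s [as_ sc gs]] := integrator_left_near ac cb d0.
  have cs0 : 0 < c - s by rewrite subr_gt0.
  (* A point [s'] of [S] lies between [s] and [c], and the variation on [[s', c]] is at most 1. *)
  have [s' Ss'] := sup_adherent cs0 hS; rewrite -/c subKr => ss'.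
  have [as' s'b TVs'] := Ss'.
  have s'c : s' <= c by apply: ub_le_sup => //; case: hS.
  rewrite (total_variationD _ as' s'c) lte_add_pinfty//.
  by rewrite (le_lt_trans (H _ _ as' s'c cb _)) ?ltry// gs// ltW.
have [cbE|] := eqVneq c b; first by rewrite -cbE; case: Sc.
rewrite neq_lt [_ < c]ltNge cb orbF => {}cb.
have [y [cy yb gy]] := integrator_right_near ac cb d0.
suff Sy : S y.
  have : y <= c by apply: ub_le_sup => //; case: hS.
  by rewrite leNgt cy.
have ay : a <= y := le_trans ac (ltW cy).
split => //; rewrite (total_variationD _ ac (ltW cy)) lte_add_pinfty//; first by case: Sc.
have /(bounded_variationP u (ltW cy)) : bounded_variation c y u.
  (* The first interval [[c, x]] of a partition may carry a jump at [c]: it contributes at most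
     [|u y - u c| + |u y - u x|], where the last term is at most 1. The other intervals lie in
     [[x, y]] with [c < x], and contribute at most 1 in total. *)
  exists (`|u y - u c| + 1 + 1) => _ [[|x s] cs <-].
    by move: cy; rewrite (itv_partition_nil cs) ltxx.
  have cx : c < x by case: cs => /= /andP[].
  have xys := itv_partition_cons cs; have xy := itv_partition_le xys.
  have Hxy : (TV x y u <= 1%:E)%E.
    by apply: H => //; [exact: le_trans ac (ltW cx)|exact: gy].
  rewrite (_ : x :: s = [:: x] ++ s)// (variation_cat (c := x))//; last 2 first.
  - exact: ltW.
  - exact: itv_partition1.
  rewrite lerD//; last first.
    rewrite -lee_fin; apply: le_trans Hxy; apply: ereal_sup_ubound.
    by exists (variation x y u s) => //; exists s.
  rewrite /variation/= big_nat1/= -[u x](subrK (u y)) -addrA.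
  apply: (le_trans (ler_normD _ _)); rewrite [leLHS]addrC lerD2l distrC -lee_fin.
  exact: le_trans (total_variation_ge _ xy) Hxy.
by rewrite ge0_fin_numE// total_variation_ge0// ltW.
Qed.

End bounded_variation.

(** * Merging a finite list of intervals into a disjoint one *)

Section interval_lists.
Context {R : realType}.
Implicit Types (p q r : R * R) (L : seq (R * R)).

Definition itv_union L : set R := \big[setU/set0]_(p <- L) `[p.1, p.2[%classic.

Definition itv_hull p q := (Num.min p.1 q.1, Num.max p.2 q.2).

Definition proper_itv p := p.1 <= p.2.

Lemma proper_hull p q : proper_itv p -> proper_itv (itv_hull p q).
Proof. by rewrite /proper_itv/= ge_min !le_max => ->. Qed.

Lemma itv_hull_union p q : ~~ itv_apart p q ->
  `[(itv_hull p q).1, (itv_hull p q).2[%classic =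
  `[p.1, p.2[%classic `|` `[q.1, q.2[%classic.
Proof.
rewrite negb_or -!ltNge => /andP[qp pq]; apply/seteqP; split => x /=.
  rewrite !in_itv/= ge_min lt_max => /andP[H1 H2].
  have [xp|px] := ltP x p.2; have [px1|xp1] := leP p.1 x; rewrite ?andbT.
  - by left.
  - right; rewrite (lt_trans xp1 pq) andbT.
    by move: H1; rewrite leNgt xp1.
  - right; rewrite (le_trans (ltW qp) px)/=.
    by move: H2; rewrite ltNge px.
  - by right; rewrite (le_trans (ltW qp) px) (lt_trans xp1 pq).
by rewrite !in_itv/= ge_min lt_max => -[/andP[-> ->]|/andP[-> ->]]; rewrite ?orbT.
Qed.

(** As [p] and [q] overlap, [r] cannot sit between them: it is on the same side of both. *)
Lemma apart_hull p q r : proper_itv r -> ~~ itv_apart p q ->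
  itv_apart r p -> itv_apart r q -> itv_apart r (itv_hull p q).
Proof.
rewrite /proper_itv /itv_apart/= le_min ge_max negb_or -!ltNge => rr /andP[qp pq].
move=> /orP[rp|pr] /orP[rq|qr].
- by rewrite rp rq.
- by have := lt_le_trans pq (le_trans qr (le_trans rr rp)); rewrite ltxx.
- by have := lt_le_trans qp (le_trans pr (le_trans rr rq)); rewrite ltxx.
- by rewrite pr qr orbT.
Qed.

(* Two half-open intervals that are not apart have their hull as union, so that
   any finite union of intervals can be made disjoint by merging. *)
Fixpoint insert_itv p L : seq (R * R) :=
  if L is q :: L' then
    if itv_apart p q then q :: insert_itv p L' else insert_itv (itv_hull p q) L'
  else [:: p].

Lemma insert_itv_union p L :
  itv_union (insert_itv p L) = `[p.1, p.2[%classic `|` itv_union L.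
Proof.
rewrite /itv_union; elim: L p => [|q L ih] p /=; first by rewrite big_seq1 big_nil setU0.
case: ifPn => pq; first by rewrite !big_cons ih setUCA.
by rewrite ih itv_hull_union// big_cons setUA.
Qed.

Lemma insert_itv_apart r p L : proper_itv r -> itv_apart r p ->
  all (itv_apart r) L -> all (itv_apart r) (insert_itv p L).
Proof.
move=> rr; elim: L p => [p /= -> //|q L ih p rp /= /andP[rq rL]].
case: ifPn => pq /=; first by rewrite rq ih.
by rewrite ih// apart_hull.
Qed.

Lemma insert_itv_pairwise p L : proper_itv p -> all proper_itv L ->
  pairwise itv_apart L ->
  all proper_itv (insert_itv p L) && pairwise itv_apart (insert_itv p L).
Proof.
elim: L p => [p /= -> //|q L ih p pp /= /andP[qq LL] /andP[qL pL]].
case: ifPn => pq /=; last by apply: ih => //; exact: proper_hull.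
have /andP[-> ->] := ih _ pp LL pL.
by rewrite qq insert_itv_apart// itv_apartC.
Qed.

Lemma disjoint_itv_list L : all proper_itv L -> exists L',
  [/\ all proper_itv L', pairwise itv_apart L' & itv_union L' = itv_union L].
Proof.
elim: L => [_|p L ih /= /andP[pp /ih[L' [L'p L'a L'L]]]]; first by exists [::].
have /andP[H1 H2] := insert_itv_pairwise pp L'p L'a.
exists (insert_itv p L'); split => //.
by rewrite insert_itv_union L'L /itv_union big_cons.
Qed.

End interval_lists.

(** * Values of the Borel measure on finite unions of intervals, and its total mass *)

Section borel_measure.
Context {R : realType} (a b : R) (g : integrator a b).
Local Notation m := (borel_stieltjes_measure g).
Let ab : a <= b. Proof. exact/ltW/(integrator_lt g). Qed.

Lemma opp_preimage_itv (s t : R) :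
  @opp_fun R @^-1` `[s, t[%classic = `](- t), (- s)]%classic.
Proof.
apply/seteqP; split => x /=; rewrite !in_itv/= /opp_fun.
  by move=> /andP[? ?]; rewrite ltrNl lerNr; apply/andP.
by rewrite ltrNl lerNr => /andP[? ?]; apply/andP.
Qed.

(** Clipping covers intervals that leave [[a, b]], as those of a countable cover may. *)
Lemma borel_stieltjes_measure_clip (s t : R) : s <= t ->
  m `[s, t[%classic = (g (clip a b t) - g (clip a b s))%:E.
Proof.
move=> st; rewrite /borel_stieltjes_measure/= /pushforward opp_preimage_itv.
rewrite /lebesgue_stieltjes_measure /measure_extension/= measurable_mu_extE/=; last first.
  exact: is_ocitv.
by rewrite wlength_itv_bnd ?lerN2// /reflected !opprK addrC.
Qed.

Lemma measurable_itv_union (L : seq (R * R)) : 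
  measurable (itv_union L : set (measurableTypeR R)).
Proof. by apply: bigsetU_measurable => p _; exact: measurable_itv. Qed.

Lemma borel_stieltjes_measure_union (L : seq (R * R)) :
  all proper_itv L -> pairwise itv_apart L ->
  m (itv_union L) = (\sum_(p <- L) (g (clip a b p.2) - g (clip a b p.1)))%:E.
Proof.
elim: L => [_ _|p L ih /= /andP[pp LL] /andP[pL aL]].
  by rewrite /itv_union !big_nil measure0.
rewrite [itv_union _]big_cons big_cons EFinD -ih// -borel_stieltjes_measure_clip//.
rewrite measureU//; first exact: measurable_itv_union.
apply/seteqP; split => // x /= [xp]; rewrite /itv_union -bigcup_seq => -[q /= qL xq].
exact: (itv_apart_disjoint (allP pL _ qL) xp xq).
Qed.

Lemma clip_itv_family (L : seq (R * R)) : all proper_itv L -> pairwise itv_apart L ->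
  itv_family a b [seq (clip a b p.1, clip a b p.2) | p <- L].
Proof.
move=> LL aL; apply/andP; split.
  rewrite all_map; apply/allP => p pL /=.
  rewrite (clip_ge a b) (clip_le g) andbT/=.
  by rewrite clip_nd//; exact: (allP LL).
rewrite pairwise_map; apply: sub_pairwise aL => p q /orP[pq|pq]; rewrite /itv_apart/=.
  by rewrite clip_nd.
by rewrite [X in _ || X]clip_nd ?orbT.
Qed.

Lemma setT_itv_bigcup : [set: R] = \bigcup_n `[- n%:R, n%:R[%classic.
Proof.
apply/seteqP; split => // x _; exists (Num.truncn `|x|).+1 => //=.
have : `|x| < (Num.truncn `|x|).+1%:R by exact: truncnS_gt.
by rewrite ltr_norml in_itv/= => /andP[/ltW -> ->].
Qed.

(** The intervals [[-n, n[] exhaust the line, and the clipped increment of [g] over each is at most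
    [g b - g a]. *)
Lemma borel_stieltjes_measureT : (m setT <= (g b - g a)%:E)%E.
Proof.
rewrite setT_itv_bigcup.
have mI n : measurable (`[- n%:R, n%:R[%classic : set (measurableTypeR R)).
  exact: measurable_itv.
have ndI : nondecreasing_seq (fun n => `[- n%:R, n%:R[%classic : set R).
  move=> i j ij; apply/subsetPset => x /=; rewrite !in_itv/= => /andP[ix xi].
  by rewrite (le_trans _ ix) ?lerN2 ?ler_nat// (lt_le_trans xi)// ler_nat.
have /cvg_lim <- // := @nondecreasing_cvg_mu _ _ _ m _ mI
  (bigcup_measurable (fun n _ => mI n)) ndI.
apply: lime_le.
  apply: ereal_nondecreasing_is_cvgn => i j ij; rewrite /= le_measure ?inE//.
  exact/subsetPset/ndI.
apply: nearW => n /=.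
rewrite borel_stieltjes_measure_clip ?lee_fin; last first.
  by rewrite (le_trans (y := 0))// oppr_le0.
by rewrite lerB// integrator_nd// ?(clip_ge a b)// ?(clip_le g).
Qed.

End borel_measure.

Section borel_stieltjes_finite.
Context {R : realType} (a b : R) (g : integrator a b).

Let fin_borel_stieltjes_measure : fin_num_fun (borel_stieltjes_measure g).
Proof.
move=> A mA; rewrite ge0_fin_numE//; apply: le_lt_trans (ltry (g b - g a)).
by apply: le_trans (borel_stieltjes_measureT g); rewrite le_measure ?inE.
Qed.

HB.instance Definition _ := @Measure_isFinite.Build _ _ _
  (borel_stieltjes_measure g) fin_borel_stieltjes_measure.

End borel_stieltjes_finite.

(** * Absolute continuity of functions gives absolute continuity of measures *)

Section domination.
Context {R : realType} (a b : R) (g h : integrator a b).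
Hypothesis ach : seq_AC a b g h.
Local Notation m := (borel_stieltjes_measure g).

(** The measure of the reflected set is an infimum over countable covers by intervals []x, y]], and
    each of these reflects back to [[- y, - x[]. *)
Lemma borel_stieltjes_cover (A : set R) (d : R) : m A = 0%E -> 0 < d ->
  exists s : (R * R)^nat, [/\ forall k, proper_itv (s k),
    A `<=` \bigcup_k `[(s k).1, (s k).2[%classic &
    (\sum_(k <oo) m `[(s k).1, (s k).2[%classic < d%:E)%E].
Proof.
move=> mA d0; have : (m A < d%:E)%E by rewrite mA lte_fin.
rewrite {1}/borel_stieltjes_measure /pushforward /lebesgue_stieltjes_measure.
rewrite /measure_extension => /ereal_inf_lt[_ [F [mF AF] <-] Fd].
have /choice[c Fc] k : exists c : R * R, proper_itv c /\
    F k = @opp_fun R @^-1` `[c.1, c.2[%classic.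
  have /ocitvP[->|[[x y] /= xy ->]] := mF k.
    by exists (0, 0); rewrite /proper_itv/= set_itvco0 preimage_set0.
  exists (- y, - x); rewrite opp_preimage_itv/= !opprK; split => //.
  by rewrite /proper_itv/= lerN2 ltW.
exists c; split => [k|x Ax|]; first by case: (Fc k).
  have [k _ Fkx] : (\bigcup_k F k) (- x) by apply: AF; rewrite /= /opp_fun opprK.
  by exists k => //; case: (Fc k) => _ FcE; rewrite FcE /= /opp_fun opprK in Fkx.
rewrite (eq_eseriesr (g := fun k => wlength (reflected g) (F k)))// => k _.
rewrite /borel_stieltjes_measure /pushforward -(Fc k).2.
by rewrite /lebesgue_stieltjes_measure /measure_extension measurable_mu_extE.
Qed.

(** Cover a [g]-null set by intervals of total [g]-mass below the [d] attached to [e]. Absolute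
    continuity bounds the [h]-mass of every finite subunion by [e], and monotone convergence extends
    this to the whole cover. *)
Lemma borel_stieltjes_dominates :
  borel_stieltjes_measure h `<< borel_stieltjes_measure g.
Proof.
move=> N nullN A mA AN; have mA0 : m A = 0%E by exact: nullN.
apply/eqP; rewrite eq_le measure_ge0 andbT; apply/lee_addgt0Pr => e e0.
rewrite add0e; have [d d0 ach_d] := ach e0.
have [s [ps As sd]] := borel_stieltjes_cover mA0 d0.
pose U n : set (measurableTypeR R) := \big[setU/set0]_(k < n) `[(s k).1, (s k).2[%classic.
have mU n : measurable (U n) by apply: bigsetU_measurable => k _; exact: measurable_itv.
have Ue n : (borel_stieltjes_measure h (U n) <= e%:E)%E.
  pose L := [seq s (val k) | k : 'I_n].
  have UL : U n = itv_union L by rewrite /itv_union big_image.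
  (* The intervals of the cover may overlap, while [ach_d] speaks of families that are apart: they
     are merged first. *)
  have [|L' [pL' aL' L'L]] := @disjoint_itv_list _ L.
    by apply/allP => _ /mapP[k _ ->].
  rewrite UL -L'L borel_stieltjes_measure_union// lee_fin.
  have := ach_d _ (clip_itv_family g pL' aL').
  rewrite !big_map/= => H; apply: ltW; apply: le_lt_trans (H _).
    by apply: ler_sum => p _; exact: ler_norm.
  (* The sum of [g]-increments over the merged family is the mass of [U n], which Boole's inequality
     compares with the cover. *)
  rewrite -lte_fin -borel_stieltjes_measure_union// L'L -UL.
  apply: le_lt_trans sd.
  have := @Boole_inequality _ _ _ m (fun k => `[(s k).1, (s k).2[%classic) n.
  move=> /(_ (fun k _ => measurable_itv _))/le_trans; apply.
  rewrite -(big_mkord xpredT (fun k => m `[(s k).1, (s k).2[%classic)).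
  exact: nneseries_lim_ge.
have ndU : nondecreasing_seq U.
  move=> i j ij; apply/subsetPset.
  exact: (subset_bigsetU (F := fun k => `[(s k).1, (s k).2[%classic)).
apply: (@le_trans _ _ (borel_stieltjes_measure h (\bigcup_n U n))).
  rewrite le_measure ?inE//; first exact: bigcup_measurable.
  move=> x /As[k _ xk]; exists k.+1 => //; rewrite /U big_ord_recr/=; by right.
have /cvg_lim <- // := @nondecreasing_cvg_mu _ _ _ (borel_stieltjes_measure h) _ mU
  (bigcup_measurable (fun n _ => mU n)) ndU.
apply: lime_le; last exact: nearW.
apply: ereal_nondecreasing_is_cvgn => i j ij; rewrite /= le_measure ?inE//.
exact/subsetPset/ndU.
Qed.

End domination.

(** * Existence of a Borel density *)

Section density.
Context {R : realType} (a b : R) (g : integrator a b).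
Local Notation m := (borel_stieltjes_measure g).

(** Stated for the Borel measure rather than its completion: Radon-Nikodym and Fubini are applied
    there. *)
Definition borel_density (u : R -> R) (v : measurableTypeR R -> R) :=
  m.-integrable `[a, b[ (EFin \o v) /\
  forall t, a <= t <= b -> u t = u a + \int[m]_(x in `[a, t[) v x.

(** Absolute continuity transfers left-continuity from [g] to [h]. Hence [h] is itself an
    integrator, whose measure is dominated by that of [g], and [v] is the Radon-Nikodym
    derivative. *)
Lemma nondecreasing_seq_AC_density (h : R -> R) : seq_AC a b g h ->
  (forall s t, a <= s -> s <= t -> t <= b -> h s <= h t) ->
  exists v, borel_density h v.
Proof.
move=> ach ndh.
have lch t : a < t -> t <= b -> h x @[x --> t^'-] --> h t.
  move=> at_ tb; apply/cvgrPdist_lt => e /ach[d d0 Hd].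
  have [s [as_ st gs]] := integrator_left_near g at_ tb d0.
  near=> x; have sx : s < x by near: x; exact: nbhs_left_gt.
  have xt : x < t by near: x; exact: nbhs_left_lt.
  have := Hd [:: (x, t)]; rewrite !big_seq1/=; apply; last first.
    by apply: gs; exact: ltW.
  by rewrite /itv_family/= (ltW xt) tb (le_trans as_ (ltW sx)).
pose H := Integrator (integrator_lt g) ndh lch.
have := @radon_nikodym_sigma_finite _ _ _ m (borel_stieltjes_measure H).
case; first exact: borel_stieltjes_dominates.
move=> f [f0 ff fi fE]; exists (fine \o f).
have fineK' : EFin \o (fine \o f) = f by apply/funext => x /=; rewrite fineK.
split.
  by rewrite fineK'; apply: integrableS fi => //; exact: measurable_itv.
move=> t /andP[at_ tb].
have eH := borel_stieltjes_measure_itv H (lexx a) at_ tb.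
have hE := etrans (esym eH) (fE `[a, t[%classic (measurable_itv _)).
rewrite /Rintegral (eq_integral f); last by move=> x _; rewrite /= fineK.
by rewrite -hE addrC subrK.
Unshelve. all: by end_near. Qed.

Lemma borel_density_lin (c : R) u1 v1 u2 v2 :
  borel_density u1 v1 -> borel_density u2 v2 ->
  borel_density (fun t => u1 t + c * u2 t) (fun t => v1 t + c * v2 t).
Proof.
move=> [iv1 Hv1] [iv2 Hv2]; split.
  by apply: (integrableD _ iv1 (integrableZl _ c iv2)); exact: measurable_itv.
move=> t tab; rewrite (Hv1 t tab) (Hv2 t tab).
have iS v : m.-integrable `[a, b[ (EFin \o v) -> m.-integrable `[a, t[ (EFin \o v).
  move=> iv; apply: integrableS iv => //.
  by move=> x /=; rewrite !in_itv/= => /andP[-> /lt_le_trans ->//]; case/andP : tab.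
have mt : measurable (`[a, t[%classic : set (measurableTypeR R)) := measurable_itv _.
rewrite (RintegralD mt (iS _ iv1) (integrableZl mt c (iS _ iv2))).
by rewrite (RintegralZl c mt (iS _ iv2)); ring.
Qed.

Lemma eq_borel_density u v v' : {in `[a, b[, v =1 v'} ->
  borel_density u v -> borel_density u v'.
Proof.
move=> vv' [iv uE]; split.
  by apply: eq_integrable iv => // x; rewrite inE/= => xab; rewrite /= vv'.
move=> t tab; rewrite (uE t tab); congr (_ + _); apply: eq_Rintegral => x.
rewrite inE/= in_itv/= => /andP[ax xt]; apply: vv'; rewrite in_itv/= ax.
by rewrite (lt_le_trans xt)//; case/andP : tab.
Qed.

Lemma seq_AC_density (u : R -> R) : seq_AC a b g u -> exists v, borel_density u v.
Proof.
move=> acu; have TVb := seq_AC_bounded_variation acu.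
have ab : a <= b := ltW (integrator_lt g).
have TVfin s t : a <= s -> s <= t -> t <= b -> total_variation s t u \is a fin_num.
  move=> as_ st tb; rewrite ge0_fin_numE ?total_variation_ge0//.
  apply: le_lt_trans TVb; rewrite (total_variationD u as_ (le_trans st tb)).
  rewrite (total_variationD u st tb).
  rewrite -[leLHS]add0e leeD ?total_variation_ge0//.
  by rewrite -[leLHS]adde0 leeD ?total_variation_ge0.
pose V t := fine (total_variation a t u).
have VE s t : a <= s -> s <= t -> t <= b -> V t - V s = fine (total_variation s t u).
  move=> as_ st tb; rewrite /V (total_variationD u as_ st) fineD ?TVfin//.
    by rewrite addrC addKr.
  exact: le_trans st tb.
have uV s t : a <= s -> s <= t -> t <= b -> `|u t - u s| <= V t - V s.
  move=> as_ st tb; rewrite VE// -lee_fin fineK ?TVfin//.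
  exact: total_variation_ge.
have ndV s t : a <= s -> s <= t -> t <= b -> V s <= V t.
  by move=> as_ st tb; rewrite -subr_ge0 (le_trans _ (uV _ _ as_ st tb)).
have acV (e : R) : 0 < e -> exists2 d : R, 0 < d & forall L, itv_family a b L ->
    \sum_(p <- L) (g p.2 - g p.1) < d -> \sum_(p <- L) (V p.2 - V p.1) < e.
  (* Half of [e], because the bound on total variations is only a weak inequality. *)
  move=> e0; have [|d d0 Hd] := seq_AC_total_variation acu (e := e / 2).
    by rewrite divr_gt0.
  exists d => // L fL /(Hd _ fL) H; apply: (@le_lt_trans _ _ (e / 2)); last first.
    by rewrite ltr_pdivrMr// ltr_pMr// ltr1n.
  rewrite -lee_fin -sumEFin; apply: le_trans H.
  rewrite big_seq [leRHS]big_seq; apply: lee_sum => p pL.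
  have [ap pp pb] := itv_family_bounds fL pL.
  by rewrite VE// fineK// TVfin.
have [v1 dv1] : exists v, borel_density V v.
  apply: nondecreasing_seq_AC_density => // e /acV[d d0 Hd].
  exists d => // L fL /(Hd _ fL); apply: le_lt_trans.
  rewrite big_seq [leRHS]big_seq; apply: ler_sum => p pL.
  have [ap pp pb] := itv_family_bounds fL pL.
  by rewrite ger0_norm// subr_ge0 ndV.
have [v2 dv2] : exists v, borel_density (fun t => V t - u t) v.
  apply: nondecreasing_seq_AC_density => [e e0|s t as_ st tb]; last first.
    have := le_trans (ler_norm _) (uV s t as_ st tb).
    by lra.
  (* An increment of [V - u] is at most twice that of [V], hence the half. *)
  have e20 : 0 < e / 2 by rewrite divr_gt0.
  have [d d0 Hd] := acV _ e20.
  exists d => // L fL /(Hd _ fL) H; rewrite [ltRHS]splitr.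
  apply: le_lt_trans (ltrD H H); rewrite -big_split/=.
  rewrite big_seq [leRHS]big_seq; apply: ler_sum => p pL.
  have [ap pp pb] := itv_family_bounds fL pL.
  have := uV _ _ ap pp pb; have := ndV _ _ ap pp pb; rewrite -subr_ge0 => V0 uVp.
  rewrite (_ : _ - _ = (V p.2 - V p.1) - (u p.2 - u p.1)); last by ring.
  by rewrite (le_trans (ler_normB _ _))// (ger0_norm V0) lerD2l.
exists (fun t => v1 t + -1 * v2 t).
rewrite (_ : u = fun t => V t + -1 * (V t - u t)); first exact: borel_density_lin.
by apply/funext => t; ring.
Qed.

End density.

(** * Integration by parts through Fubini on a triangle *)

Section integration_by_parts.
Context {R : realType} (m : {sigma_finite_measure set (measurableTypeR R) -> \bar R}).
Variables (a t : R) (v w : measurableTypeR R -> R).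
Let E : set (measurableTypeR R) := `[a, t[%classic.
Hypothesis iv : m.-integrable E (EFin \o v).
Hypothesis iw : m.-integrable E (EFin \o w).

Let mE : measurable E. Proof. exact: measurable_itv. Qed.

Let integrable_ext (f : measurableTypeR R -> R) : m.-integrable E (EFin \o f) ->
  m.-integrable setT (EFin \o (f \_ E)).
Proof. by move=> /(integrable_mkcond _ mE); rewrite restrict_EFin. Qed.

(** The product [v(x) w(y)] on the open triangle [x < y]. Extension by zero outside [E] puts all the
    integrals on the whole plane. *)
Let kernel (z : measurableTypeR R * measurableTypeR R) : \bar R :=
  ((v \_ E) z.1 * (w \_ E) z.2 * ((z.1 : R) < z.2)%R%:R)%:E.

Let measurable_patch (f : measurableTypeR R -> R) : m.-integrable E (EFin \o f) ->
  measurable_fun setT (f \_ E).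
Proof. by move=> /integrable_ext /measurable_int /measurable_EFinP. Qed.

Let measurable_prod : measurable_fun setT
  (fun z : measurableTypeR R * measurableTypeR R => (v \_ E) z.1 * (w \_ E) z.2).
Proof.
apply: measurable_funM.
  by apply: measurableT_comp; [exact: measurable_patch|exact: measurable_fst].
by apply: measurableT_comp; [exact: measurable_patch|exact: measurable_snd].
Qed.

Let measurable_kernel : measurable_fun setT kernel.
Proof.
apply/measurable_EFinP; apply: measurable_funM; first exact: measurable_prod.
rewrite (_ : (fun _ => _) =
  \1_[set z : measurableTypeR R * measurableTypeR R | (z.1 : R) < z.2]).
  apply: measurable_indic.
  rewrite -[X in measurable X]setTI.
  apply: (@measurable_lte _ _ R setT measurableT (EFin \o fst) (EFin \o snd)).
    by apply/measurable_EFinP; exact: measurable_fst.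
  by apply/measurable_EFinP; exact: measurable_snd.
by apply/funext => z; rewrite indicE mem_setE.
Qed.

Let integrable_prod : (m \x m)%E.-integrable setT
  (fun z : measurableTypeR R * measurableTypeR R => ((v \_ E) z.1 * (w \_ E) z.2)%:E).
Proof.
apply/integrable12ltyP; first by apply/measurable_EFinP; exact: measurable_prod.
have mn (f : measurableTypeR R -> R) : m.-integrable E (EFin \o f) ->
    measurable_fun setT (fun x => (`|(f \_ E) x|)%:E).
  move=> intf; apply/measurable_EFinP/measurableT_comp => //.
  exact: measurable_patch.
(* The iterated integral of the absolute value factors into the product of the two finite norms. *)
rewrite (eq_integral (fun x =>
  (`|(v \_ E) x|)%:E * \int[m]_y (`|(w \_ E) y|)%:E)%E); last first.
  move=> x _; rewrite -ge0_integralZl//; last exact: mn.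
  by apply: eq_integral => y _; rewrite /= normrM EFinM.
rewrite ge0_integralZr//; [|exact: mn|by apply: integral_ge0 => y _; rewrite lee_fin].
rewrite lte_mul_pinfty//.
- by apply: integral_ge0 => y _; rewrite lee_fin.
- rewrite ge0_fin_numE; last by apply: integral_ge0 => y _; rewrite lee_fin.
  by have /integrableP[] := integrable_ext iv.
by have /integrableP[] := integrable_ext iw.
Qed.

Let integrable_kernel : (m \x m)%E.-integrable setT kernel.
Proof.
apply: le_integrable integrable_prod => // z _; rewrite lee_fin normrM ler_piMr//.
by case: (_ < _); rewrite ?normr0 ?normr1.
Qed.

Let integrable_sub (f : measurableTypeR R -> R) (A : set R) :
  m.-integrable E (EFin \o f) -> measurable (A : set (measurableTypeR R)) ->
  A `<=` E -> m.-integrable A (EFin \o f).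
Proof. by move=> fi mA AE; apply: integrableS fi. Qed.

Let kernel_F (x : R) : (\int[m]_y kernel (x, y) =
  ((v \_ E) x * \int[m]_(y in `]x, t[) w y)%:E)%E.
Proof.
have [xE|xE] := boolP (x \in E); last first.
  rewrite {1}/patch (negbTE xE) mul0r; apply: integral0_eq => y _.
  by rewrite /kernel/= {1}/patch (negbTE xE) !mul0r.
have /andP[ax xt] : a <= x < t by move: xE; rewrite inE /E/= in_itv/=.
have sE : `]x, t[ `<=` E.
  by move=> y /=; rewrite /E/= !in_itv/= => /andP[xy ->]; rewrite (le_trans ax (ltW xy)).
have mI : measurable (`]x, t[%classic : set (measurableTypeR R)) := measurable_itv _.
have iwx : m.-integrable `]x, t[%classic (EFin \o w).
  exact: integrable_sub.
rewrite EFinM /Rintegral fineK; last exact: integrable_fin_num.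
rewrite integral_mkcond -integralZl//; last first.
  exact/(integrable_mkcond _ mI).
apply: eq_integral => y _; rewrite /kernel/= EFinM EFinM -muleA; congr (_ * _)%E.
rewrite restrict_EFin/= -EFinM; congr EFin.
rewrite /patch !mem_setE /E/= !in_itv/=.
case: (ltP x y) => xy /=; last by rewrite mulr0.
by rewrite mulr1 (le_trans ax (ltW xy)).
Qed.

Let kernel_G (y : R) : (\int[m]_x kernel (x, y) =
  ((w \_ E) y * \int[m]_(x in `[a, y[) v x)%:E)%E.
Proof.
have [yE|yE] := boolP (y \in E); last first.
  rewrite {1}/patch (negbTE yE) mul0r; apply: integral0_eq => x _.
  by rewrite /kernel/= [(w \_ E) y]/patch (negbTE yE) mulr0 mul0r.
have /andP[ay yt] : a <= y < t by move: yE; rewrite inE /E/= in_itv/=.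
have sE : `[a, y[ `<=` E.
  by move=> x /=; rewrite /E/= !in_itv/= => /andP[-> xy]; rewrite (lt_trans xy yt).
have mI : measurable (`[a, y[%classic : set (measurableTypeR R)) := measurable_itv _.
have ivy : m.-integrable `[a, y[%classic (EFin \o v).
  exact: integrable_sub.
rewrite EFinM /Rintegral fineK; last exact: integrable_fin_num.
rewrite integral_mkcond -integralZl//; last first.
  exact/(integrable_mkcond _ mI).
apply: eq_integral => x _.
rewrite /kernel/= [(v \_ E) x * _]mulrC -mulrA EFinM; congr (_ * _)%E.
rewrite restrict_EFin/=; congr EFin.
rewrite /patch !mem_setE /E/= !in_itv/=.
case: (ltP x y) => xy /=; last by rewrite mulr0 andbF.
by rewrite mulr1 andbT (lt_trans xy yt) andbT.
Qed.

Let U y := \int[m]_(x in `[a, y[) v x.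
(** Closed at [x], unlike [U]: the diagonal, which [kernel] omits, is counted here, and this is what
    later produces the posterior trace. *)
Let W x := \int[m]_(y in `[a, x]) w y.

Let W_E x : x \in E -> W x = \int[m]_(y in E) w y - \int[m]_(y in `]x, t[) w y.
Proof.
move=> xE; have /andP[ax xt] : a <= x < t by move: xE; rewrite inE /E/= in_itv/=.
have EU : E = `[a, x]%classic `|` `]x, t[%classic.
  by rewrite /E -itv_bndbnd_setU// bnd_simp//=.
have mI1 : measurable (`[a, x]%classic : set (measurableTypeR R)) := measurable_itv _.
have mI2 : measurable (`]x, t[%classic : set (measurableTypeR R)) := measurable_itv _.
rewrite /W [in RHS]EU (Rintegral_setU mI1 mI2); first by rewrite addrK.
  by rewrite -EU.
apply/disj_setPS => y []/=; rewrite !in_itv/= => /andP[_ yx] /andP[xy].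
by rewrite ltNge yx in xy.
Qed.

(** Its absolute value integrates to at most the finite double integral of the absolute value of
    [kernel]. *)
Let integrable_G : m.-integrable setT (fun y => \int[m]_x kernel (x, y))%E.
Proof.
apply/integrableP; split; first exact: measurable_fubini_G integrable_kernel.
have /integrable21ltyP := integrable_kernel.
move=> /(_ measurable_kernel); apply: le_lt_trans.
have mk : measurable_fun setT (abse \o kernel) by exact: measurableT_comp.
apply: ge0_le_integral => //.
- by apply: measurableT_comp => //; exact: measurable_fubini_G integrable_kernel.
- by apply: (measurable_fun_fubini_tonelli_G (abse \o kernel)) => //= z.
- move=> y _; apply: le_abse_integral => //.
  exact: measurableT_comp.
Qed.

Lemma integrable_by_parts_l : m.-integrable E (EFin \o (fun y => w y * U y)).
Proof.
apply/(integrable_mkcond _ mE).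
have := integrable_G; under eq_fun do rewrite kernel_G.
apply: eq_integrable => // y _; rewrite restrict_EFin/= /U /patch.
by case: ifP; rewrite ?mul0r.
Qed.

Let integrable_FF : m.-integrable E (EFin \o (fun x => v x * \int[m]_(y in `]x, t[) w y)).
Proof.
apply/(integrable_mkcond _ mE).
have := integrable_fubini_F integrable_kernel.
rewrite /fubini_F; under eq_fun do rewrite kernel_F.
apply: eq_integrable => // y _; rewrite restrict_EFin/= /patch.
by case: ifP; rewrite ?mul0r.
Qed.

(** By [W_E], this is a constant multiple of [v] minus [v] times the tail integral of [w]. *)
Lemma integrable_by_parts_r : m.-integrable E (EFin \o (fun x => v x * W x)).
Proof.
have := integrableB mE (integrableZl mE (\int[m]_(y in E) w y) iv) integrable_FF.
apply: eq_integrable => // x xE /=.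
by rewrite W_E// mulrBr EFinB [in RHS]mulrC EFinM.
Qed.

(** Integrating [kernel] in either order identifies the [U]-term with the integral of [v] times the
    tail of [w] over []x, t[]. That tail and [W x] add up to the full integral of [w]. *)
Lemma Rintegral_by_parts : \int[m]_(x in E) v x * \int[m]_(y in E) w y =
  \int[m]_(y in E) (w y * U y) + \int[m]_(x in E) (v x * W x).
Proof.
have FG : \int[m]_(x in E) (v x * \int[m]_(y in `]x, t[) w y) =
    \int[m]_(y in E) (w y * U y).
  rewrite /Rintegral; congr fine.
  have H : (\int[m]_x ((v \_ E) x * \int[m]_(y in `]x, t[) w y)%:E =
      \int[m]_y ((w \_ E) y * U y)%:E)%E.
    transitivity (\int[m]_x \int[m]_y kernel (x, y))%E.
      by apply: eq_integral => x _; rewrite kernel_F.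
    rewrite (Fubini integrable_kernel).
    by apply: eq_integral => y _; rewrite kernel_G.
  rewrite integral_mkcond [in RHS]integral_mkcond.
  rewrite (eq_integral (fun x =>
    ((v \_ E) x * \int[m]_(y in `]x, t[) w y)%:E)); last first.
    by move=> x _; rewrite restrict_EFin/= /patch; case: ifP; rewrite ?mul0r.
  rewrite H; apply: eq_integral.
  by move=> x _; rewrite restrict_EFin/= /patch /U; case: ifP; rewrite ?mul0r.
rewrite -FG -RintegralD//; last exact: integrable_by_parts_r.
rewrite mulrC -RintegralZl//; apply: eq_Rintegral => x xE.
by rewrite (W_E xE) mulrBr addrC subrK mulrC.
Qed.

End integration_by_parts.

(** * Transfer to the completed measure, and functions with vanishing integrals *)

Section completion.
Context {R : realType} (a b : R) (g : integrator a b).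
Local Notation m := (borel_stieltjes_measure g).
Local Notation mu := (stieltjes_measure g).
Local Notation cT := (caratheodory_type (mu_ext m)).

(** The identity as a map between two sigma-algebras: [m] agrees on Borel sets with the pushforward
    of [mu] along it, so integrals transfer by change of variables. *)
Definition completion_id : cT -> measurableTypeR R := id.

Lemma caratheodory_borel (A : set R) : measurable (A : set (measurableTypeR R)) ->
  measurable (A : set cT).
Proof. exact: caratheodory_measurable_mu_ext. Qed.

Lemma stieltjes_measure_borel (A : set R) :
  measurable (A : set (measurableTypeR R)) -> mu A = m A.
Proof. exact: measurable_mu_extE. Qed.

Lemma measurable_completion_id : measurable_fun setT completion_id.
Proof. by move=> _ A mA; rewrite setTI; exact: caratheodory_borel. Qed.

Lemma measurable_fun_completion d' (T' : measurableType d') (D : set R) (f : R -> T') :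
  measurable_fun (D : set (measurableTypeR R)) (f : measurableTypeR R -> T') ->
  measurable (D : set (measurableTypeR R)) ->
  measurable_fun (D : set cT) (f : cT -> T').
Proof.
by move=> mf mD _ A mA; apply: caratheodory_borel; exact: mf.
Qed.

Lemma ge0_integral_completion (D : set R) (f : R -> \bar R) :
  measurable (D : set (measurableTypeR R)) ->
  measurable_fun (D : set (measurableTypeR R)) f -> (forall x, 0 <= f x)%E ->
  (\int[mu]_(x in D) f x = \int[m]_(x in D) f x)%E.
Proof.
move=> mD mf f0.
have := @ge0_integral_pushforward _ _ _ _ R completion_id measurable_completion_id
  mu D f mD mf (fun x _ => f0 x).
rewrite (_ : completion_id @^-1` D = D)// => <-.
apply: eq_measure_integral => [|? A mA _]; first exact: measurable_completion_id.
exact: (stieltjes_measure_borel mA).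
Qed.

Lemma integrable_completion (D : set R) (f : R -> \bar R) :
  measurable (D : set (measurableTypeR R)) ->
  m.-integrable D f -> mu.-integrable D f.
Proof.
move=> mD /integrableP[mf foo]; apply/integrableP; split.
  exact: measurable_fun_completion.
by rewrite ge0_integral_completion//; exact: measurableT_comp.
Qed.

Lemma integral_completion (D : set R) (f : R -> \bar R) :
  measurable (D : set (measurableTypeR R)) ->
  measurable_fun (D : set (measurableTypeR R)) f ->
  (\int[mu]_(x in D) f x = \int[m]_(x in D) f x)%E.
Proof.
move=> mD mf; rewrite [LHS]integralE [RHS]integralE.
by congr (_ - _)%E; apply: ge0_integral_completion => //;
  [exact: measurable_funepos|exact: measurable_funeneg].
Qed.

Lemma Rintegral_completion (D : set R) (f : R -> R) :
  measurable (D : set (measurableTypeR R)) ->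
  m.-integrable D (EFin \o f) -> \int[mu]_(x in D) f x = \int[m]_(x in D) f x.
Proof.
by move=> mD /integrableP[mf _]; rewrite /Rintegral integral_completion.
Qed.

(** Covers by Borel sets approximate the outer measure of [E] within [1/(n+1)]; the intersection
    over [n] of their unions is the hull. Finiteness of [mu] allows the measures to be
    subtracted. *)
Lemma borel_hull (E : set R) : measurable (E : set cT) -> exists B : set R,
  [/\ measurable (B : set (measurableTypeR R)), E `<=` B & mu (B `\` E) = 0%E].
Proof.
move=> mE.
have mT : measurable ([set: R] : set (measurableTypeR R)) by exact: measurableT.
have muT : (mu setT < +oo)%E.
  rewrite stieltjes_measure_borel//; apply: le_lt_trans (borel_stieltjes_measureT g) _.
  exact: ltry.
have muE A : measurable (A : set cT) -> (mu A < +oo)%E.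
  by move=> mA; apply: le_lt_trans muT; rewrite le_measure ?inE.
have H (n : nat) : exists B : set R, [/\ measurable (B : set (measurableTypeR R)),
    E `<=` B & (mu B <= mu E + (n.+1%:R^-1)%:E)%E].
  have n0 : 0 < n.+1%:R^-1 :> R by rewrite invr_gt0.
  have finE : mu E \is a fin_num by rewrite ge0_fin_numE// muE.
  have [_ [F [mF EF] <-] FE] := lb_ereal_inf_adherent n0 finE.
  exists (\bigcup_k F k); split => //; first exact: bigcup_measurable.
  apply: le_trans (ltW FE).
  rewrite stieltjes_measure_borel; last exact: bigcup_measurable.
  apply: measure_sigma_subadditive => //; exact: bigcup_measurable.
have [B /all_and3[mB EB BE]] := choice H.
exists (\bigcap_n B n); split; first exact: bigcapT_measurable.
  by move=> x Ex n _; exact: EB.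
have mcB : measurable (\bigcap_n B n : set cT).
  by apply: caratheodory_borel; exact: bigcapT_measurable.
apply/eqP; rewrite eq_le measure_ge0 andbT; apply/lee_addgt0Pr => e e0.
(* This index makes [1/(n+1)] at most [e]. *)
rewrite add0e; pose n := Num.truncn e^-1.
have ne : n.+1%:R^-1 <= e.
  by rewrite invf_ple ?posrE// ltW// truncnS_gt.
apply: (@le_trans _ _ (mu (B n `\` E))).
  rewrite le_measure ?inE//.
  - exact: measurableD.
  - by apply: measurableD => //; exact: caratheodory_borel.
  - by move=> x [Bx nEx]; split => //; exact: Bx.
rewrite measureD//; [|exact: caratheodory_borel|by apply: muE; exact: caratheodory_borel].
rewrite (setIidr (EB n)) leeBlDl ?ge0_fin_numE ?muE//.
by apply: le_trans (BE n) _; rewrite leeD2l// lee_fin.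
Qed.

(** Vanishing on the intervals [[a, t[] spreads to Borel sets by Dynkin's theorem, then to all sets
    of the completion by Borel hulls; a function whose integral vanishes on every measurable set is
    null a.e. *)
Lemma stieltjes_integral_eq0 (f : R -> R) :
  mu.-integrable `[a, b[ (EFin \o f) ->
  (forall t, a <= t <= b -> \int[mu]_(x in `[a, t[) f x = 0) ->
  {ae mu, forall t, t \in `[a, b[ -> f t = 0}.
Proof.
move=> intf f0.
have ab : a <= b := ltW (integrator_lt g).
pose D : set cT := `[a, b[%classic.
have mI (i : interval R) : measurable ([set` i] : set cT).
  by apply: caratheodory_borel; exact: measurable_itv.
have mD : measurable D by exact: mI.
have intS A : measurable A -> mu.-integrable (A `&` D) (EFin \o f).
  by move=> mA; apply: integrableS intf => //; exact: measurableI.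
have I0 t : a <= t <= b -> (\int[mu]_(x in `[a, t[) (f x)%:E = 0)%E.
  move=> tab; have tI : mu.-integrable `[a, t[ (EFin \o f).
    apply: integrableS intf => // x /=; rewrite !in_itv/= => /andP[-> xt].
    by rewrite (lt_le_trans xt)//; case/andP: tab.
  rewrite -[LHS]fineK; first by congr EFin; exact: f0.
  exact: integrable_fin_num.
have borel0 (A : set R) : measurable (A : set (measurableTypeR R)) ->
    (\int[mu]_(x in A `&` D) (f x)%:E = 0)%E.
  move=> mA; have : (@RGenInftyO.G R).-sigma.-measurable A.
    by rewrite -RGenInftyO.measurableE.
  move: A {mA}; apply: (@dynkin_induction _ (measurableTypeR R) (@RGenInftyO.G R)
    (fun A => (\int[mu]_(x in A `&` D) (f x)%:E = 0)%E)).
  - exact: RGenInftyO.measurableE.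
  - move=> _ _ [x ->] [y ->]; exists (Num.min x y).
    apply/seteqP; split => z /=; rewrite !in_itv/= lt_min; first by move=> [-> ->].
    by move=> /andP[].
  - by rewrite setTI; apply: I0; rewrite ab lexx.
  (* The generators are the rays []-oo, x[], whose traces on [[a, b[] are covered by [I0]. *)
  - move=> _ [x ->]; rewrite (_ : _ `&` _ = `[a, clip a b x[%classic).
      by apply: I0; rewrite clip_ge (clip_le g).
    apply/seteqP; split => y; rewrite /D/= !in_itv/= /clip lt_max lt_min.
      by move=> [-> /andP[-> ->]]; rewrite orbT.
    move=> /andP[ay /orP[ya|/andP[-> ->]]]; last by rewrite ay.
    by rewrite ltNge ay in ya.
  - move=> S0' /caratheodory_borel; set S : set cT := S0' => mS S0.
    have mSD : measurable (S `&` D : set cT) by exact: measurableI.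
    have mSCD : measurable (~` S `&` D : set cT).
      by apply: measurableI => //; exact: measurableC.
    have DE : D = (S `&` D) `|` (~` S `&` D) by rewrite -setIUl setUv setTI.
    have D0 : (\int[mu]_(x in D) (f x)%:E = 0)%E by apply: I0; rewrite ab lexx.
    rewrite -D0 [in RHS]DE integral_setU//; first by rewrite S0 add0e.
      by rewrite -DE; exact: measurable_int intf.
    by apply/disj_setPS => y [[Sy _] [nSy _]].
  - move=> F mF tF F0; rewrite setI_bigcupl integral_bigcup.
    + by apply: eseries0 => k _ _; exact: F0.
    + exact: trivIset_setIr.
    + by move=> k; apply: measurableI => //; exact: caratheodory_borel.
    + rewrite -setI_bigcupl; apply: intS; apply: caratheodory_borel.
      exact: bigcup_measurable.
(* [E] differs from [B] intersected with [D] by a null set, where [B] is its Borel hull. *)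
have E0 E : E `<=` D -> measurable E ->
    (\int[mu]_(x in E) (f x)%:E = \int[mu]_(x in E) (cst 0 x))%E.
  move=> ED mE; rewrite integral0.
  have [B [mB EB BE]] := borel_hull mE.
  rewrite -(borel0 _ mB); apply/esym.
  have mB' : measurable (B : set cT) by exact: caratheodory_borel.
  have mBD : measurable (B `&` D : set cT) by exact: measurableI.
  have mBDE : measurable ((B `&` D) `\` E : set cT) by exact: measurableD.
  rewrite (negligible_integral mBDE mBD).
  - by rewrite setDD setIC setIidl// => x Ex; split; [exact: EB|exact: ED].
  - by apply: intS; exact: caratheodory_borel.
  - apply/eqP; rewrite eq_le measure_ge0 andbT -BE le_measure ?inE//.
      by apply: measurableD => //; exact: caratheodory_borel.
    by move=> x [[Bx _] nEx].
have := integral_ae_eq mD intf (measurable_cst 0%E) E0.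
apply: filterS => t /= H tD; suff [] : (f t)%:E = 0%E by [].
by apply: H; move: tD; rewrite /D/=.
Qed.

End completion.

(** * Right limits, the posterior trace and the product rule for real functions *)

Section real_product.
Context {R : realType} (a b : R) (g : integrator a b).
Local Notation m := (borel_stieltjes_measure g).
Local Notation bT := (measurableTypeR R).

Let mI (i : interval R) : measurable ([set` i] : set bT).
Proof. exact: measurable_itv. Qed.

(** Dominated convergence with bound [|v|]: along [s n > t] tending to [t], the indicators of [[a, s
    n[] tend pointwise to that of [[a, t]], the point [t] lying in every interval. *)
Lemma Rintegral_right_limit (v : R -> R) (t : R) :
  m.-integrable `[a, b[ (EFin \o v) -> a <= t < b ->
  \int[m]_(y in `[a, x[) v y @[x --> t^'+] --> \int[m]_(y in `[a, t]) v y.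
Proof.
move=> intv /andP[at_ tb]; apply/cvg_at_rightP => s [ts st].
pose D : set bT := `[a, b[%classic.
have intvD : m.-integrable D (EFin \o v) by [].
have itv_sub (i : interval R) : [set` i] `<=` D -> D `&` [set` i] = [set` i].
  by move=> iD; exact: setIidr.
have lim_s : \forall n \near \oo,
    \int[m]_(y in D `&` `[a, s n[) v y = \int[m]_(y in `[a, s n[) v y.
  near=> n; rewrite itv_sub// => y /=; rewrite /D/= !in_itv/= => /andP[-> ysn].
  rewrite (lt_le_trans ysn)//.
  by near: n; move/cvgr_le : st; apply.
apply: cvg_trans (near_eq_cvg lim_s) _.
rewrite -(itv_sub `[a, t]); last first.
  by move=> y /=; rewrite /D/= !in_itv/= => /andP[-> yt]; exact: le_lt_trans tb.
rewrite Rintegral_mkcondr; under eq_fun do rewrite Rintegral_mkcondr.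
pose f_ n (y : bT) := ((v \_ `[a, s n[) y)%:E.
pose f (y : bT) := ((v \_ `[a, t]) y)%:E.
have mf (i : interval R) : measurable_fun D (fun y : bT => ((v \_ [set` i]) y)%:E).
  have : measurable_fun D ((EFin \o v) \_ [set` i]).
    apply/(measurable_restrict _ (mI i) (mI _)).
    have mv := measurable_int _ intvD.
    by apply: measurable_funS mv => //; exact: mI.
  by rewrite restrict_EFin.
have [|||||intf _ cvgI] :=
  @dominated_convergence _ _ _ m D (mI _) f_ f (fun y => `|(v y)%:E|%E).
- by move=> n; exact: mf.
- exact: mf.
- apply/aeW => y Dy; rewrite /f_ /f.
  have /andP[ay yb] : a <= y < b by move: Dy; rewrite /D/= in_itv.
  have [yt|ty] := leP y t.
    have -> : ((v \_ `[a, t]) y)%:E = (v y)%:E.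
      by rewrite /patch ifT// inE/= in_itv/= ay yt.
    have -> : (fun n => ((v \_ `[a, s n[) y)%:E) = cst (v y)%:E.
      apply/funext => n; rewrite /patch ifT// inE/= in_itv/= ay.
      exact: le_lt_trans (ts n).
    exact: cvg_cst.
  have -> : ((v \_ `[a, t]) y)%:E = 0%E.
    by rewrite /patch ifF// mem_setE in_itv/= ay leNgt ty.
  apply: cvg_near_cst; near=> n.
  rewrite /patch ifF// mem_setE in_itv/= ay ltNge.
  suff -> : s n <= y by [].
  by near: n; move/cvgr_le : st; apply.
- exact: integrable_abse.
- apply/aeW => y n _; rewrite /f_ /= lee_fin /patch.
  by case: ifP; rewrite ?normr0.
have fin_f : (\int[m]_(y in D) f y)%E \is a fin_num.
  by apply: integrable_fin_num; first exact: mI.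
move: cvgI; rewrite -(fineK fin_f) => /fine_cvgP[_].
exact.
Unshelve. all: by end_near. Qed.

Lemma borel_density_right_limit (u v : R -> R) (t : R) : borel_density g u v ->
  a <= t < b -> u x @[x --> t^'+] --> u a + \int[m]_(y in `[a, t]) v y.
Proof.
move=> [intv uE] tab; have /andP[at_ tb] := tab.
apply: (@cvg_trans _ (u a + \int[m]_(y in `[a, x[) v y @[x --> t^'+])).
  apply: near_eq_cvg; near=> x; rewrite -uE//.
  have tx : t <= x by near: x; exact: nbhs_right_ge.
  by rewrite (le_trans at_ tx)/=; near: x; exact: nbhs_right_le.
by apply: cvgD; [exact: cvg_cst|exact: Rintegral_right_limit].
Unshelve. all: by end_near. Qed.

(** At a jump point both sides are the right limit of [u]. Elsewhere [{t}] is null, so closing the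
    interval at [t] does not change the integral. *)
Lemma posterior_trace_density (u v : R -> R) (t : R) : borel_density g u v ->
  a <= t < b ->
  posterior_trace (k := RealScalar) g u t = u a + \int[m]_(y in `[a, t]) v y.
Proof.
move=> duv tab; have [intv uE] := duv; have /andP[at_ tb] := tab.
rewrite /posterior_trace; case: ifPn => [_|tJ].
  by apply/cvg_lim; [exact: Rhausdorff|exact: borel_density_right_limit].
(* [g] has density 1, so the right-limit formula applied to [g] itself identifies the jump of [g] at
   [t] with the mass of [{t}]. *)
have dg : borel_density g g (cst 1).
  split; first exact: (finite_measure_integrable_cst m 1 (mI _)).
  move=> s /andP[as_ sb].
  have e := borel_stieltjes_measure_itv g (lexx a) as_ sb.
  have -> : \int[m]_(x in `[a, s[) cst 1 x = g s - g a.
    by rewrite (Rintegral_cst m (mI _)) mul1r; exact: (congr1 fine e).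
  by rewrite addrC subrK.
have at1 : `[a, t[%classic `|` [set t] = `[a, t]%classic by rewrite setUitv1// bnd_simp.
have mt : measurable ([set t] : set bT) by exact: measurable_set1.
have disj : `[a, t[%classic `&` [set t] = set0.
  apply/seteqP; split => // y [] /=; rewrite in_itv/= => /andP[_ yt] yE.
  by rewrite yE ltxx in yt.
have mt0 : m [set t] = 0%E.
  have mfin : m [set t] \is a fin_num by exact: fin_num_measure.
  have mat : m `[a, t]%classic = ((g t - g a)%:E + m [set t])%E.
    rewrite -at1 (measureU m (mI _) mt disj); congr (_ + _)%E.
    exact: (borel_stieltjes_measure_itv g (lexx a) at_ (ltW tb)).
  have gt0 : lim (g x @[x --> t^'+]) - g t <= 0.
    by rewrite leNgt; apply: contra tJ => J; rewrite inE.
  have lg : lim (g x @[x --> t^'+]) = g a + \int[m]_(y in `[a, t]) cst 1 y.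
    by apply/cvg_lim; [exact: Rhausdorff|exact: borel_density_right_limit dg tab].
  have I1 : \int[m]_(y in `[a, t]) cst 1 y = g t - g a + fine (m [set t]).
    rewrite (Rintegral_cst m (mI _)) mul1r.
    by have := congr1 fine mat; rewrite fineD.
  move: gt0; rewrite lg I1 => gt0.
  apply/eqP; rewrite eq_le measure_ge0 andbT -(fineK mfin) lee_fin.
  move: gt0 => /=; lra.
rewrite uE ?at_ ?(ltW tb)//; congr (_ + _).
rewrite /Rintegral; congr fine; apply/esym.
have iat : m.-integrable `[a, t] (EFin \o v).
  apply: integrableS intv => //.
  by move=> y /=; rewrite !in_itv/= => /andP[-> /le_lt_trans ->].
rewrite (negligible_integral mt (mI _) iat mt0).
by rewrite setDitv1r.
Qed.

(** With [u1 = u1 a + U] and the trace of [u2] equal to [u2 a + W], the integrand splits into two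
    constant multiples of densities and the two terms of integration by parts. *)
Lemma borel_densityM (u1 v1 u2 v2 : R -> R) :
  borel_density g u1 v1 -> borel_density g u2 v2 ->
  borel_density g (fun t => u1 t * u2 t)
    (fun t => u1 t * v2 t + v1 t * posterior_trace (k := RealScalar) g u2 t).
Proof.
move=> d1 d2; have [i1 u1E] := d1; have [i2 u2E] := d2.
pose U y := \int[m]_(x in `[a, y[) v1 x.
pose W x := \int[m]_(y in `[a, x]) v2 y.
have hE t : t <= b -> {in `[a, t[, forall x,
    u1 x * v2 x + v1 x * posterior_trace (k := RealScalar) g u2 x =
    (u1 a * v2 x + v2 x * U x) + (u2 a * v1 x + v1 x * W x)}.
  move=> tb x; rewrite in_itv/= => /andP[ax xt]; have xb := lt_le_trans xt tb.
  rewrite (posterior_trace_density d2) ?ax// u1E ?ax ?(ltW xb)// -/(U x) -/(W x).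
  by ring.
have iS t v : a <= t <= b -> m.-integrable `[a, b[ (EFin \o v) ->
    m.-integrable `[a, t[ (EFin \o v).
  move=> /andP[at_ tb] iv; apply: integrableS iv => //.
  by move=> x /=; rewrite !in_itv/= => /andP[-> /lt_le_trans ->].
have iZ t c v : m.-integrable `[a, t[ (EFin \o v) ->
    m.-integrable `[a, t[ (EFin \o (fun x => c * v x)).
  by move=> iv; exact: (integrableZl (mI _) c iv).
have iD t (f h : R -> R) : m.-integrable `[a, t[ (EFin \o f) ->
    m.-integrable `[a, t[ (EFin \o h) ->
    m.-integrable `[a, t[ (EFin \o (fun x => f x + h x)).
  by move=> intf inth; exact: (integrableD (mI _) intf inth).
have iA t : a <= t <= b ->
    m.-integrable `[a, t[ (EFin \o (fun x => u1 a * v2 x + v2 x * U x)).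
  move=> tab; apply: iD; first by apply: iZ; exact: iS.
  by apply: integrable_by_parts_l; exact: iS.
have iB t : a <= t <= b ->
    m.-integrable `[a, t[ (EFin \o (fun x => u2 a * v1 x + v1 x * W x)).
  move=> tab; apply: iD; first by apply: iZ; exact: iS.
  by apply: integrable_by_parts_r; exact: iS.
have abb : a <= b <= b by rewrite lexx (ltW (integrator_lt g)).
split.
  have := iD _ _ _ (iA _ abb) (iB _ abb); apply: eq_integrable => //.
  by move=> x; rewrite inE/= => xab; rewrite /= -(hE b).
move=> t tab; have /andP[_ tb] := tab.
rewrite (@eq_Rintegral _ _ _ m _ (fun x => (u1 a * v2 x + v2 x * U x) +
  (u2 a * v1 x + v1 x * W x))); last first.
  by move=> x; rewrite inE/= => xt; exact: (hE t).
rewrite (RintegralD (mI _) (iA _ tab) (iB _ tab)).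
have i1t := iS _ _ tab i1; have i2t := iS _ _ tab i2.
rewrite (RintegralD (mI _) (iZ _ (u1 a) _ i2t) (integrable_by_parts_l i1t i2t)).
rewrite (RintegralD (mI _) (iZ _ (u2 a) _ i1t) (integrable_by_parts_r i1t i2t)).
rewrite (RintegralZl _ (mI _) i2t) (RintegralZl _ (mI _) i1t).
have := Rintegral_by_parts i1t i2t; rewrite -/U -/W.
rewrite (u1E t tab) (u2E t tab) => E.
rewrite mulrDl !mulrDr E; ring.
Qed.

End real_product.

(** * Absolute continuity over both scalar fields: components and products *)

Lemma normc_ge_Im (R : rcfType) (x : R[i]) : (`|complex.Im x|%:C <= `|x|)%C.
Proof.
by case: x => x y; simpc; rewrite -sqrtr_sqr ler_wsqrtr// lerDr sqr_ge0.
Qed.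

Lemma normc_le_ReIm (R : rcfType) (x : R[i]) :
  (`|x| <= (`|complex.Re x| + `|complex.Im x|)%:C)%C.
Proof.
rewrite normc_def lecR -[leRHS]ger0_norm; last by rewrite addr_ge0.
rewrite -[leRHS]sqrtr_sqr ler_wsqrtr//.
rewrite -[in leLHS](real_normK (num_real (complex.Re x))).
rewrite -[in leLHS](real_normK (num_real (complex.Im x))).
(* After squaring, the two sides differ by twice this cross term. *)
have : 0 <= `|complex.Re x| * `|complex.Im x| by rewrite mulr_ge0.
by nra.
Qed.

Section scalar_AC.
Context {R : realType} (k : scalar_kind) (a b : R) (g : integrator a b).
Local Notation F := (scalar_field R k).

(** Norms of elements of [F] are themselves in [F], so real bounds have to be carried there. *)
Definition scalar_embed : R -> F :=
  match k with RealScalar => id | ComplexScalar => real_complex R end.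

Lemma scalar_embed_lt x y : (scalar_embed x < scalar_embed y) = (x < y).
Proof. by rewrite /scalar_embed; case: k => //=; exact: ltcR. Qed.

Lemma scalar_embed0 : scalar_embed 0 = 0.
Proof. by rewrite /scalar_embed; case: k. Qed.

Lemma scalar_embedD x y : scalar_embed (x + y) = scalar_embed x + scalar_embed y.
Proof. by rewrite /scalar_embed; case: k => //=; rewrite rmorphD. Qed.

Lemma scalar_embed_sum I (r : seq I) (f : I -> R) :
  scalar_embed (\sum_(i <- r) f i) = \sum_(i <- r) scalar_embed (f i).
Proof.
elim: r => [|i r ih]; first by rewrite !big_nil scalar_embed0.
by rewrite !big_cons scalar_embedD ih.
Qed.

(** Meant for [f] equal to [u] in the real case, and to its real or imaginary part in the complex
    case. *)
Lemma stieltjes_AC_seq (u : R -> F) (f : R -> R) :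
  (forall s t, scalar_embed `|f t - f s| <= `|u t - u s|) ->
  stieltjes_AC g u -> seq_AC a b g f.
Proof.
move=> fu acu e e0.
have [|d d0 Hd] := acu (scalar_embed e); first by rewrite -scalar_embed0 scalar_embed_lt.
exists d => // L /andP[/allP bL pL] gL.
(* [stieltjes_AC] requires [s j < t j]; the degenerate intervals dropped here contribute 0 to both
   sums. *)
pose L' := [seq p <- L | p.1 < p.2].
have eqL (h : R -> R) (H : R -> R) : H 0 = 0 ->
    \sum_(p <- L) H (h p.2 - h p.1) = \sum_(p <- L') H (h p.2 - h p.1).
  move=> H0; rewrite [RHS]big_filter [RHS]big_mkcond/= big_seq [RHS]big_seq.
  apply: eq_bigr => p /bL /and3P[_ pp _]; case: ltP => // p21.
  by rewrite (@le_anti _ _ p.1 p.2) ?pp// subrr.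
rewrite (eqL f Num.norm (normr0 _)) -scalar_embed_lt scalar_embed_sum.
pose n := size L'; pose s (j : 'I_n) := (nth (0, 0) L' j).1.
pose t (j : 'I_n) := (nth (0, 0) L' j).2.
have L'j (j : 'I_n) : nth (0, 0) L' j \in L' by exact: mem_nth.
apply: (@le_lt_trans _ _ (\sum_(j < n) `|u (t j) - u (s j)|)).
  by rewrite (big_nth (0, 0)) big_mkord; apply: ler_sum => j _; exact: fu.
apply: Hd.
- by move=> j; have := L'j j; rewrite mem_filter => /andP[].
- move=> j x /=; rewrite !in_itv/=; have := L'j j; rewrite mem_filter => /andP[_ /bL].
  by move=> /and3P[aj _ jb] /andP[jx xj]; rewrite (le_trans aj jx) (lt_le_trans xj jb).
- apply/trivIsetP => i j _ _ ij.
  wlog ltij : i j ij / (i < j)%N.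
    move=> H; have := ij; rewrite neq_ltn => /orP[/H->//|/H].
    by rewrite setIC eq_sym; apply.
  apply/seteqP; split => // x [/= xi xj].
  have /(pairwiseP (0, 0)) pL' : pairwise itv_apart L' by exact: pairwise_filter.
  by apply: (@itv_apart_disjoint _ _ _ x (pL' i j _ _ ltij)); rewrite ?inE.
- have := gL; rewrite (eqL g id)// (big_nth (0, 0)) big_mkord.
  exact.
Qed.

Lemma stieltjes_AC_mul (u phi : R -> F) (M : F) : 0 < M ->
  (forall t, a <= t <= b -> `|u t| <= M) ->
  (forall t, a <= t <= b -> `|phi t| <= M) ->
  stieltjes_AC g u -> stieltjes_AC g phi -> stieltjes_AC g (fun t => u t * phi t).
Proof.
move=> M0 uM phiM acu acphi e e0.
(* Each factor's increments get multiplied by [M], and there are two such sums. *)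
have e1 : 0 < e / (M + M) by rewrite divr_gt0// addr_gt0.
have [d1 d10 H1] := acu _ e1; have [d2 d20 H2] := acphi _ e1.
exists (Num.min d1 d2); first by rewrite lt_min d10.
move=> n s t st stab tst gst.
move: gst; rewrite lt_min => /andP[gst1 gst2].
have {}H1 := H1 n s t st stab tst gst1.
have {}H2 := H2 n s t st stab tst gst2.
have bnd (j : 'I_n) : a <= s j <= b /\ a <= t j <= b.
  have sj := ltW (st j).
  have asj : a <= s j.
    have : s j \in `[a, b[ by apply: (stab j); rewrite /= in_itv/= lexx st.
    by rewrite in_itv/= => /andP[].
  suff tjb : t j <= b by rewrite asj tjb (le_trans sj tjb) (le_trans asj sj).
  rewrite leNgt; apply/negP => btj.
  (* If [t j] exceeded [b], this point would lie in [[s j, t j[] although it is at least [b]. *)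
  have : Num.max (s j) b \in `[a, b[.
    by apply: (stab j); rewrite /= in_itv/= le_max lexx gt_max st btj.
  by rewrite in_itv/= gt_max ltxx !andbF.
have E (j : 'I_n) : `|u (t j) * phi (t j) - u (s j) * phi (s j)| <=
    M * `|phi (t j) - phi (s j)| + M * `|u (t j) - u (s j)|.
  have [sj tj] := bnd j.
  rewrite (_ : _ - _ = u (t j) * (phi (t j) - phi (s j)) +
    phi (s j) * (u (t j) - u (s j))); last by ring.
  apply: (le_trans (ler_normD _ _)); rewrite !normrM lerD// ler_wpM2r//.
    exact: uM.
  exact: phiM.
apply: (@le_lt_trans _ _ (M * \sum_j `|phi (t j) - phi (s j)| +
    M * \sum_j `|u (t j) - u (s j)|)).
  by rewrite !mulr_sumr -big_split/=; apply: ler_sum => j _.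
rewrite [ltRHS](_ : e = M * (e / (M + M)) + M * (e / (M + M))); last first.
  by rewrite -mulrDl mulrC divfK// gt_eqF// addr_gt0.
by apply: ltrD; rewrite ltr_pM2l.
Qed.

End scalar_AC.

(** * Scalar densities, the Stieltjes derivative and its uniqueness *)

Section scalar_density.
Context {R : realType} (a b : R) (g : integrator a b).
Local Notation m := (borel_stieltjes_measure g).
Local Notation mu := (stieltjes_measure g).

Definition scalar_density (k : scalar_kind) : 
    (R -> scalar_field R k) -> (R -> scalar_field R k) -> Prop :=
  match k return (R -> scalar_field R k) -> (R -> scalar_field R k) -> Prop with
  | RealScalar => fun u v : R -> R => borel_density g u v
  | ComplexScalar => fun u v : R -> R[i] =>
      borel_density g (@complex.Re R \o u) (@complex.Re R \o v) /\
      borel_density g (@complex.Im R \o u) (@complex.Im R \o v)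
  end.

Lemma seq_AC_Re (u : R -> R[i]) : stieltjes_AC (k := ComplexScalar) g u ->
  seq_AC a b g (@complex.Re R \o u).
Proof.
apply: stieltjes_AC_seq => s t /=.
by rewrite -raddfB; exact: normc_ge_Re.
Qed.

Lemma seq_AC_Im (u : R -> R[i]) : stieltjes_AC (k := ComplexScalar) g u ->
  seq_AC a b g (@complex.Im R \o u).
Proof.
apply: stieltjes_AC_seq => s t /=.
by rewrite -raddfB; exact: normc_ge_Im.
Qed.

Lemma stieltjes_AC_density k (u : R -> scalar_field R k) :
  stieltjes_AC g u -> exists v, scalar_density u v.
Proof.
case: k u => [u acu|u acu].
  apply: seq_AC_density; apply: stieltjes_AC_seq acu.
  by move=> s t.
have [v1 d1] := seq_AC_density (seq_AC_Re acu).
have [v2 d2] := seq_AC_density (seq_AC_Im acu).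
by exists (fun t => Complex (v1 t) (v2 t)).
Qed.

(** The distance from [f t] to [f a] is at most the total variation, which is finite. *)
Lemma seq_AC_bounded (f : R -> R) : seq_AC a b g f ->
  exists2 M : R, 0 <= M & forall t, a <= t <= b -> `|f t| <= M.
Proof.
move=> acf; have ab : a <= b := ltW (integrator_lt g).
have TVb := seq_AC_bounded_variation acf.
exists (`|f a| + fine (total_variation a b f)).
  by rewrite addr_ge0// fine_ge0// total_variation_ge0.
move=> t /andP[at_ tb]; rewrite -[f t](subrK (f a)) addrC.
apply: (le_trans (ler_normD _ _)); rewrite lerD2l -lee_fin fineK; last first.
  by rewrite ge0_fin_numE// total_variation_ge0.
apply: (le_trans (total_variation_ge f at_)).
by rewrite (total_variationD f at_ tb) leeDl// total_variation_ge0.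
Qed.

Lemma stieltjes_AC_bounded k (u : R -> scalar_field R k) : stieltjes_AC g u ->
  exists2 M : R, 0 <= M & forall t, a <= t <= b -> `|u t| <= scalar_embed k M.
Proof.
case: k u => [u acu|u acu].
  apply: seq_AC_bounded; apply: stieltjes_AC_seq acu.
  by move=> s t.
have [M1 M10 H1] := seq_AC_bounded (seq_AC_Re acu).
have [M2 M20 H2] := seq_AC_bounded (seq_AC_Im acu).
exists (M1 + M2); first exact: addr_ge0.
move=> t tab; apply: (le_trans (normc_le_ReIm (u t))).
by rewrite lecR lerD//; [exact: H1|exact: H2].
Qed.

Lemma stieltjes_ACM k (u phi : R -> scalar_field R k) :
  stieltjes_AC g u -> stieltjes_AC g phi -> stieltjes_AC g (fun t => u t * phi t).
Proof.
move=> acu acphi.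
have [M1 M10 H1] := stieltjes_AC_bounded acu.
have [M2 M20 H2] := stieltjes_AC_bounded acphi.
have le_embed x y : x < y -> scalar_embed k x <= scalar_embed k y.
  by move=> xy; rewrite ltW// scalar_embed_lt.
(* A common bound for both factors; the added 1 makes it positive. *)
apply: (@stieltjes_AC_mul _ _ _ _ _ u phi (scalar_embed k (M1 + M2 + 1))) => //.
- by rewrite -(scalar_embed0 k) scalar_embed_lt; lra.
- by move=> t tab; apply: (le_trans (H1 t tab)); apply: le_embed; lra.
- by move=> t tab; apply: (le_trans (H2 t tab)); apply: le_embed; lra.
Qed.

Lemma borel_density_derivative (u v : R -> R) : borel_density g u v ->
  mu.-integrable `[a, b[ (EFin \o v) /\
  forall t, a <= t <= b -> u t = u a + \int[mu]_(x in `[a, t[) v x.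
Proof.
move=> [iv uE]; split; first by apply: integrable_completion => //; exact: measurable_itv.
move=> t tab; rewrite Rintegral_completion; [exact: uE|exact: measurable_itv|].
apply: integrableS iv => //.
by move=> x /=; rewrite !in_itv/= => /andP[-> /lt_le_trans ->//]; case/andP : tab.
Qed.

Lemma scalar_density_derivative k (u v : R -> scalar_field R k) :
  scalar_density u v -> is_stieltjes_derivative g u v.
Proof.
case: k u v => [u v duv|u v [d1 d2]]; first exact: borel_density_derivative duv.
have [i1 H1] := borel_density_derivative d1.
have [i2 H2] := borel_density_derivative d2.
split; first by split.
move=> t tab; apply/eqP; rewrite eq_complex/=; apply/andP; split; apply/eqP.
  by rewrite raddfD/=; exact: H1.
by rewrite raddfD/=; exact: H2.
Qed.

#[global] Instance ae_stieltjes_filter : Filter (nbhs (almost_everywhere mu)).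
Proof. exact: ae_filter_ringOfSetsType. Qed.

(** The difference [v1 - v2] integrates to 0 over every [[a, t[]. *)
Lemma real_derivative_unique (u v1 v2 : R -> R) :
  is_stieltjes_derivative (k := RealScalar) g u v1 ->
  is_stieltjes_derivative (k := RealScalar) g u v2 ->
  {ae mu, forall t, t \in `[a, b[ -> v1 t = v2 t}.
Proof.
move=> [i1 H1] [i2 H2].
have mI t : measurable (`[a, t[%classic : set (caratheodory_type (mu_ext m))).
  by apply: caratheodory_borel; exact: measurable_itv.
have := @stieltjes_integral_eq0 _ _ _ g (fun x => v1 x - v2 x).
have -> : EFin \o (fun x => v1 x - v2 x) = ((EFin \o v1) \- (EFin \o v2))%E by [].
move=> /(_ (integrableB (mI b) i1 i2)) H.
have : {ae mu, forall t, t \in `[a, b[ -> v1 t - v2 t = 0}.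
  apply: H => t tab.
  have iS v : mu.-integrable `[a, b[ (EFin \o v) -> mu.-integrable `[a, t[ (EFin \o v).
    move=> iv; apply: integrableS iv => //.
    by move=> x /=; rewrite !in_itv/= => /andP[-> /lt_le_trans ->//]; case/andP : tab.
  rewrite (RintegralB (mI t) (iS _ i1) (iS _ i2)).
  have := H1 t tab; rewrite (H2 t tab) => /addrI E.
  by apply/eqP; rewrite subr_eq0; apply/eqP/esym; exact: E.
by apply: filterS => t H' tab; apply/eqP; rewrite -subr_eq0; apply/eqP/H'.
Qed.

Lemma stieltjes_derivative_unique k (u v1 v2 : R -> scalar_field R k) :
  is_stieltjes_derivative g u v1 -> is_stieltjes_derivative g u v2 ->
  {ae mu, forall t, t \in `[a, b[ -> v1 t = v2 t}.
Proof.
case: k u v1 v2 => [u v1 v2|u v1 v2 [[i1 i1'] H1] [[i2 i2'] H2]].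
  exact: real_derivative_unique.
have HRe : {ae mu, forall t, t \in `[a, b[ -> complex.Re (v1 t) = complex.Re (v2 t)}.
  apply: (@real_derivative_unique (@complex.Re R \o u)); split => // t tab /=.
    by rewrite (H1 t tab) raddfD.
  by rewrite (H2 t tab) raddfD.
have HIm : {ae mu, forall t, t \in `[a, b[ -> complex.Im (v1 t) = complex.Im (v2 t)}.
  apply: (@real_derivative_unique (@complex.Im R \o u)); split => // t tab /=.
    by rewrite (H1 t tab) raddfD.
  by rewrite (H2 t tab) raddfD.
apply: filterS2 HRe HIm => t HRe HIm tab.
by apply/eqP; rewrite eq_complex (HRe tab) (HIm tab) !eqxx.
Qed.

(** The density provides right limits of both components, so the limit in [R[i]] exists and is taken
    componentwise. *)
Lemma complex_posterior_trace (u v : R -> R[i]) (t : R) :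
  scalar_density (k := ComplexScalar) u v -> a <= t < b ->
  posterior_trace (k := ComplexScalar) g u t =
  Complex (posterior_trace (k := RealScalar) g (@complex.Re R \o u) t)
          (posterior_trace (k := RealScalar) g (@complex.Im R \o u) t).
Proof.
move=> [d1 d2] tab.
rewrite (posterior_trace_density d1 tab) (posterior_trace_density d2 tab).
have l1 := borel_density_right_limit d1 tab.
have l2 := borel_density_right_limit d2 tab.
have p1 := posterior_trace_density d1 tab.
have p2 := posterior_trace_density d2 tab.
move: p1 p2; rewrite /posterior_trace; case: ifPn => [_ _ _|_ <- <-]; last first.
  by rewrite /=; case: (u t).
apply/cvg_lim; first exact: norm_hausdorff.
(* A positive [e] in [R[i]] has imaginary part 0; half of its real part goes to each component. *)
apply/cvgrPdist_lt => e; rewrite ltcE/= => /andP[/eqP Ime0 Ree0].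
have e20 : 0 < complex.Re e / 2 by rewrite divr_gt0.
move/cvgrPdist_lt : l1 => /(_ _ e20) near1; move/cvgrPdist_lt : l2 => /(_ _ e20) near2.
near=> x; apply: (le_lt_trans (normc_le_ReIm _)).
rewrite ltcE/= Ime0 eqxx/= !raddfB/= [ltRHS]splitr ltrD//.
  by near: x.
by near: x.
Unshelve. all: by end_near. Qed.

(** In the complex case the real rule is applied to the four products of components, which are
    recombined by linearity. *)
Lemma scalar_densityM k (u1 v1 u2 v2 : R -> scalar_field R k) :
  scalar_density u1 v1 -> scalar_density u2 v2 ->
  scalar_density (fun t => u1 t * u2 t)
    (fun t => u1 t * v2 t + v1 t * posterior_trace g u2 t).
Proof.
case: k u1 v1 u2 v2 => [u1 v1 u2 v2|u1 v1 u2 v2 d1 d2]; first exact: borel_densityM.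
have [d1r d1i] := d1; have [d2r d2i] := d2.
split.
- have := borel_density_lin (-1) (borel_densityM d1r d2r) (borel_densityM d1i d2i).
  rewrite (_ : @complex.Re R \o (fun t => u1 t * u2 t) =
    fun t => complex.Re (u1 t) * complex.Re (u2 t) +
    -1 * (complex.Im (u1 t) * complex.Im (u2 t))); last first.
    by apply/funext => t; rewrite /=; case: (u1 t) (u2 t) => [? ?] [? ?] /=; ring.
  apply: eq_borel_density => t; rewrite in_itv/= => tab.
  rewrite (complex_posterior_trace d2 tab).
  by rewrite /=; case: (u1 t) (v1 t) (v2 t) => [? ?] [? ?] [? ?] /=; ring.
have := borel_density_lin 1 (borel_densityM d1r d2i) (borel_densityM d1i d2r).
rewrite (_ : @complex.Im R \o (fun t => u1 t * u2 t) =
  fun t => complex.Re (u1 t) * complex.Im (u2 t) +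
  1 * (complex.Im (u1 t) * complex.Re (u2 t))); last first.
  by apply/funext => t; rewrite /=; case: (u1 t) (u2 t) => [? ?] [? ?] /=; ring.
apply: eq_borel_density => t; rewrite in_itv/= => tab.
rewrite (complex_posterior_trace d2 tab).
by rewrite /=; case: (u1 t) (v1 t) (v2 t) => [? ?] [? ?] [? ?] /=; ring.
Qed.

Lemma stieltjes_derivativeP k (u v : R -> scalar_field R k) :
  scalar_density u v ->
  {ae mu, forall t, t \in `[a, b[ -> stieltjes_derivative g u t = v t}.
Proof.
move=> /scalar_density_derivative duv.
have dxu : is_stieltjes_derivative g u (stieltjes_derivative g u).
  (* The default value 0 is not returned, as [v] is a derivative of [u]. *)
  by apply: (xgetPex (fun=> 0)); exists v.
exact: (stieltjes_derivative_unique dxu duv).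
Qed.

End scalar_density.

Theorem corollary3p2 (R : realType) (k : scalar_kind) (a b : R)
    (g : integrator a b) (mass_gt0 : 0 < g b - g a)
    (u phi : R -> scalar_field R k) (acu : stieltjes_AC g u) (acphi : stieltjes_AC g phi) :
  stieltjes_AC g (fun t => u t * phi t) /\
  {ae stieltjes_measure g, forall t, t \in `[a, b[ ->
    stieltjes_derivative g (fun t => u t * phi t) t =
      u t * stieltjes_derivative g phi t +
      stieltjes_derivative g u t * posterior_trace g phi t /\
    stieltjes_derivative g (fun t => u t * phi t) t =
      posterior_trace g u t * stieltjes_derivative g phi t +
      stieltjes_derivative g u t * phi t}.
Proof.
split; first exact: stieltjes_ACM.
have [v du] := stieltjes_AC_density acu; have [w dphi] := stieltjes_AC_density acphi.
have Du := stieltjes_derivativeP du; have Dphi := stieltjes_derivativeP dphi.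
have leibniz := stieltjes_derivativeP (scalar_densityM du dphi).
(* The second formula is the first one with the factors exchanged. *)
have leibnizC := stieltjes_derivativeP (scalar_densityM dphi du).
have uphiC : (fun t => phi t * u t) = (fun t => u t * phi t).
  by apply/funext => t; rewrite mulrC.
rewrite uphiC in leibnizC.
apply: filterS2 (filterI Du Dphi) (filterI leibniz leibnizC).
move=> t [Dut Dphit] [lt lCt] tab; rewrite (Dut tab) (Dphit tab).
by split; [exact: lt|rewrite (lCt tab) addrC mulrC [phi t * _]mulrC].
Qed.
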